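(* Let $X$ be a real Banach space and let $A: X^*\to X^{**}$ be linear and continuous. Assume that $\operatorname{ran} A\subseteq X$ and that there exists $e\in X^{**}\setminus X$ such that $$\langle Ax^*,x^*\rangle=\langle e,x^*\rangle^2,\quad \forall x^*\in X^*.$$ Let $P$ and $S$ be respectively the symmetric part and the skew (antisymmetric) part of $A$. Let $T:X\rightrightarrows X^*$ be defined by $$\operatorname{gra} T:=\{(-Sx^*,x^* )\mid x^*\in X^*, \langle e,x^*\rangle=0\}=\{(-Ax^*,x^* )\mid x^*\in X^*, \langle e,x^*\rangle=0\}$$ (the two sets being equal). Let $f:X\to\,]-\infty,+\infty]$ be proper, lower semicontinuous and convex, and set $F:=f\oplus f^*$ on $X\times X^*$, i.e. $F(x,x^* )=f(x)+f^*(x^* )$. Then the following hold. (i) $A$ is a maximally monotone operator on $X^*$ that is neither of type (D) nor unique. (ii) $Px^*=\langle x^*,e\rangle e$ for all $x^*\in X^*$. (iii) $T$ is maximally monotone and skew on $X$. (iv) $\operatorname{gra} T^*=\{(Sx^*+re,x^* )\mid x^*\in X^*,\ r\in\mathbb R\}$. (v) $-T$ is not maximally monotone. (vi) $T$ is not of type (D). (vii) $F_T=\iota_C$, where $C:=\{(-Ax^*,x^* )\mid x^*\in X^*\}$. (viii) $T$ is not unique. (ix) $T$ is not of type (BR). (x) If $\operatorname{dom} T\cap\operatorname{int}\operatorname{dom}\partial f\neq\varnothing$, then $T+\partial f$ is maximally monotone. (xi) $F$ and $F_T$ are BC-functions on $X\times X^*$. (xii) Moreover, $\bigcup_{\lambda>0}\lambda\big(P_{X^*}(\operatorname{dom}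 F_T)-P_{X^*}(\operatorname{dom} F)\big)=X^*$, while, assuming that there exists $(v_0,v_0^* )\in X\times X^*$ such that $f^*(v_0^* )+f^{**}(v_0-A^*v_0^* )<\langle v_0,v_0^*\rangle$, the function $F_T\Box_1 F$ is not a BC-function. (xiii) Assume that $\big[\operatorname{ran} A-\bigcup_{\lambda>0}\lambda\operatorname{dom} f\big]$ is a closed subspace of $X$ and that $\varnothing\neq\operatorname{dom}\big(f^{**}\circ A^*|_{X^*}\big)\not\subseteq\{e\}_\bot$. Then $T+\partial f$ is not of type (D). (xiv) Assume that $\operatorname{dom} f^{**}=X^{**}$. Then $T+\partial f$ is a maximally monotone operator that is not of type (D).
   Context: All Banach spaces are real. For a Banach space $Z$, $Z^*$ is its dual, $Z$ is identified with its canonical image in $Z^{**}$, and $\langle\cdot,\cdot\rangle$ denotes duality pairings (arguments in either order). $Z\times Z^*$ is paired with $(Z\times Z^* )^*=Z^*\times Z^{**}$ by $\langle (x,x^* ),(y^*,y^{**})\rangle=\langle x,y^*\rangle+\langle x^*,y^{**}\rangle$. The definitions below are stated for a general Banach space $Z$ and are applied with $Z=X$ (for $T$, $T+\partial f$) and $Z=X^*$ (for $A$). A set-valued operator $B:Z\rightrightarrows Z^*$ has graph $\operatorname{gra}B=\{(x,x^* )\mid x^*\in Bx\}$, domain $\operatorname{dom}B=\{x\mid Bx\ne\varnothing\}$ and range $\operatorname{ran}B=B(Z)$. $B$ is monotone if $\langle x-y,x^*-y^*\rangle\ge0$ for all $(x,x^* ),(y,y^* )\in\operatorname{gra}B$,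 and maximally monotone if moreover it has no proper monotone extension in the sense of graph inclusion. $B$ is a linear relation if $\operatorname{gra} B$ is a linear subspace; it is skew if $\langle x,x^*\rangle=0$ for all $(x,x^* )\in\operatorname{gra}B$. Adjoint: $\operatorname{gra}B^*=\{(x^{**},x^* )\in Z^{**}\times Z^*\mid (x^*,-x^{**})\in(\operatorname{gra}B)^\bot\}$, i.e. $\langle x^*,a\rangle=\langle x^{**},a^*\rangle$ for all $(a,a^* )\in\operatorname{gra}B$. The symmetric part and skew part of $B$ are $\tfrac12B+\tfrac12B^*$ and $\tfrac12B-\tfrac12B^*$ (as operators on $Z$, i.e. with $B^*$ restricted to $Z\subseteq Z^{**}$). In particular for $A$ and $x^*\in X^*$: $A^*x^*\in X^{**}$ with $\langle A^*x^*,y^*\rangle=\langle x^*,Ay^*\rangle$ for all $y^*\in X^*$, $Px^*=\tfrac12(Ax^*+A^*x^* )$, $Sx^*=\tfrac12(Ax^*-A^*x^* )$. A maximally monotone $B:Z\rightrightarrows Z^*$ is: - of type (D) if for every $(x^{**},x^* )\in Z^{**}\times Z^*$ with $\inf_{(a,a^* )\in\operatorname{gra}B}\langle a-x^{**},a^*-x^*\rangle\ge0$ there is a bounded net in $\operatorname{gra}B$ converging weak$^*\times$strong to $(x^{**},x^* )$; - of type (BR) if whenever $(x,x^* )\in Z\times Z^*$, $\alpha,\beta>0$ and $\inf_{(a,a^* )\in\operatorname{gra}B}\langle x-a,x^*-a^*\rangle>-\alpha\beta$, there exists $(b,b^* )\in\operatorname{gra}B$ with $\|x-b\|<\alpha$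 and $\|x^*-b^*\|<\beta$; - unique if all maximally monotone extensions of $B$ (graph inclusion) in $Z^{**}\times Z^*$ coincide (monotonicity in $Z^{**}\times Z^*$ being with respect to the pairing of $Z^{**}$ and $Z^*$). For $f:X\to\,]-\infty,+\infty]$: $\operatorname{dom} f=f^{-1}(\mathbb R)$; $f$ is proper if $\operatorname{dom}f\ne\varnothing$; $f^*(x^* )=\sup_{x\in X}(\langle x,x^*\rangle-f(x))$ on $X^*$; $f^{**}=(f^* )^*$ on $X^{**}$; $\partial f(x)=\{x^*\in X^*\mid \langle y-x,x^*\rangle+f(x)\le f(y)\ \forall y\in X\}$. $\iota_C$ is the indicator function ($0$ on $C$, $+\infty$ off $C$). $\{e\}_\bot=\{x^*\in X^*\mid\langle e,x^*\rangle=0\}$. The Fitzpatrick function of $T$ is $F_T(x,x^* )=\sup_{(a,a^* )\in\operatorname{gra}T}(\langle x,a^*\rangle+\langle a,x^*\rangle-\langle a,a^*\rangle)$ on $X\times X^*$. A function $H:X\times X^*\to\,]-\infty,+\infty]$ is a BC-function if it is proper, convex and $H^*(x^*,x)\ge H(x,x^* )\ge\langle x,x^*\rangle$ for all $(x,x^* )\in X\times X^*$, where $H^*$ is the Fenchel conjugate on $X^*\times X^{**}$. $P_{X^*}:X\times X^*\to X^*$ is $(x,x^* )\mapsto x^*$. Partial inf-convolution: $(F_1\Box_1F_2)(x,x^* )=\inf_{u\in X}\big(F_1(u,x^* )+F_2(x-u,x^* )\big)$. *)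

(* Defs.v *)
From HB Require Import structures.
From mathcomp Require Import all_boot all_order all_algebra.
From mathcomp Require Import all_classical all_reals all_analysis.
Set Implicit Arguments.
Unset Strict Implicit.
Unset Printing Implicit Defensive.
Import Order.TTheory GRing.Theory Num.Theory.
Import numFieldNormedType.Exports.

Local Open Scope classical_set_scope.
Local Open Scope ring_scope.

(* [dual Z] is the space of continuous linear functionals with the operator
   norm, [dual (dual Z)] the bidual and [bidual_emb] the canonical embedding
   of [Z]; the identification of [Z] with its image is always explicit. *)
Section Dual.
Variables (R : realType) (Z : normedModType R).

Definition cont_linear : {pred (Z -> R^o)} :=
  fun f => `[< linear f /\ continuous f >].

Record dual : Type :=
  Dual { dual_fun :> Z -> R^o; dual_funP : dual_fun \in cont_linear }.

HB.instance Definition _ := [isSub for dual_fun].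
HB.instance Definition _ := [Choice of dual by <:].

Fact cont_linear_submod_closed : submod_closed cont_linear.
Proof.
split.
  apply/asboolP; split; last exact: cst_continuous.
  by move=> a x y /=; rewrite scaler0 addr0.
move=> a f g /asboolP[fl fc] /asboolP[gl gc]; apply/asboolP; split.
  move=> b x y; rewrite !fctE fl gl !scalerDr !scalerA (mulrC a b).
  by rewrite addrACA.
move=> x; apply: (@continuousD _ _ _ (fun y => a *: f y) g) => //.
  by apply: continuousZl_tmp; exact: fc.
exact: gc.
Qed.

HB.instance Definition _ :=
  GRing.isSubmodClosed.Build R (Z -> R^o) cont_linear cont_linear_submod_closed.
HB.instance Definition _ := [SubChoice_isSubLmodule of dual by <:].

Fact dual_linear (phi : dual) : linear (dual_fun phi).
Proof. by have /asboolP[] := dual_funP phi. Qed.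

HB.instance Definition _ (phi : dual) :=
  GRing.isLinear.Build R Z R^o *:%R (dual_fun phi) (dual_linear phi).

Lemma dual_continuous (phi : dual) : continuous phi.
Proof. by have /asboolP[] := dual_funP phi. Qed.

Lemma dualP (phi psi : dual) : phi =1 psi -> phi = psi.
Proof. by move=> h; apply/val_inj/funext. Qed.

Definition dual_norm (phi : dual) : R :=
  sup [set `|phi x| | x in [set x : Z | `|x| <= 1]].

Fact dual_has_sup (phi : dual) :
  has_sup [set `|phi x| | x in [set x : Z | `|x| <= 1]].
Proof.
split; first by exists `|phi 0|, 0 => //=; rewrite normr0.
have /linear_bounded_continuous/bounded_funP/(_ 1)[M hM] := @dual_continuous phi.
by exists M => _ [x x1 <-]; exact: hM.
Qed.

Lemma dual_norm_le1 (phi : dual) x : `|x| <= 1 -> `|phi x| <= dual_norm phi.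
Proof. by move=> x1; apply: sup_upper_bound; [exact: dual_has_sup|exists x]. Qed.

Lemma dual_norm_le (phi : dual) x : `|phi x| <= dual_norm phi * `|x|.
Proof.
have [->|x0] := eqVneq x 0; first by rewrite linear0 !normr0 mulr0.
have := @dual_norm_le1 phi (`|x|^-1 *: x).
rewrite linearZ !normrZ normfV normr_id mulVf ?normr_eq0// => /(_ (lexx _)).
by rewrite mulrC ler_pdivrMr ?normr_gt0.
Qed.

Fact dual_norm_ub (phi : dual) M :
  (forall x, `|x| <= 1 -> `|phi x| <= M) -> dual_norm phi <= M.
Proof.
move=> hM; apply: ge_sup; first by case: (dual_has_sup phi).
by move=> _ [x x1 <-]; exact: hM.
Qed.

Fact dual_normD (phi psi : dual) :
  dual_norm (phi + psi) <= dual_norm phi + dual_norm psi.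
Proof.
apply: dual_norm_ub => x x1; rewrite (le_trans (ler_normD _ _))//.
by rewrite lerD// dual_norm_le1.
Qed.

Fact dual_norm_ge0 (phi : dual) : 0 <= dual_norm phi.
Proof. by rewrite (le_trans _ (@dual_norm_le1 phi 0 _))// normr0. Qed.

Fact dual_normZ (l : R) (phi : dual) : dual_norm (l *: phi) = `|l| * dual_norm phi.
Proof.
have H m (psi : dual) : dual_norm (m *: psi) <= `|m| * dual_norm psi.
  by apply: dual_norm_ub => x x1; rewrite normrZ ler_wpM2l// dual_norm_le1.
apply/eqP; rewrite eq_le H/=.
have [->|l0] := eqVneq l 0; first by rewrite normr0 mul0r dual_norm_ge0.
have := H l^-1 (l *: phi); rewrite scalerA mulVf// scale1r normfV.
by rewrite mulrC ler_pdivlMr ?normr_gt0// mulrC.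
Qed.

Fact dual_norm0_eq0 (phi : dual) : dual_norm phi = 0 -> phi = 0.
Proof.
move=> phi0; apply: dualP => x; apply/eqP; rewrite -normr_le0.
by rewrite (le_trans (dual_norm_le phi x))// phi0 mul0r.
Qed.

HB.instance Definition _ :=
  Lmodule_isNormed.Build R dual dual_normD dual_normZ dual_norm0_eq0.

End Dual.

Section Canonical.
Variables (R : realType) (Z : normedModType R).

Fact cont_linear_of_bound (V : normedModType R) (g : V -> R^o) M :
  linear g -> (forall x, `|g x| <= M * `|x|) -> g \in @cont_linear R V.
Proof.
move=> gl hM; apply/asboolP; split=> //.
pose g' : {linear V -> R^o} :=
  HB.pack g (GRing.isLinear.Build R V R^o *:%R g gl).
apply: (@bounded_linear_continuous _ _ _ g'); apply/bounded_funP => r.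
exists (`|M| * r) => x xr; rewrite (le_trans (hM x))//.
by rewrite (le_trans (ler_wpM2r _ (ler_norm M)))// ler_wpM2l.
Qed.

Fact bidual_emb_subproof (z : Z) :
  (fun phi : dual Z => phi z) \in @cont_linear R (dual Z).
Proof.
apply: (@cont_linear_of_bound _ _ `|z|) => // phi.
by rewrite mulrC; exact: dual_norm_le.
Qed.

Definition bidual_emb (z : Z) : dual (dual Z) := Dual (bidual_emb_subproof z).

Variables (A : {linear Z -> dual Z}) (cA : continuous A).

Fact lin_adjoint_subproof (z : Z) : (fun y => A y z) \in @cont_linear R Z.
Proof.
apply/asboolP; split=> [a x y|]; first by rewrite linearP.
have lc := @dual_continuous _ _ (bidual_emb z).
by move=> y; apply: (@continuous_comp _ _ _ A (bidual_emb z)); [exact: cA|exact: lc].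
Qed.

(* Restriction to [Z] of the adjoint of [A]; see [adjoint_op_fun] below. *)
Definition lin_adjoint (z : Z) : dual Z := Dual (lin_adjoint_subproof z).

Definition symmetric_part (z : Z) : dual Z := 2^-1 *: (A z + lin_adjoint z).
Definition skew_part (z : Z) : dual Z := 2^-1 *: (A z - lin_adjoint z).

End Canonical.

Section Operators.
Variable R : realType.

Definition gra (U V : Type) (B : U -> set V) : set (U * V) :=
  [set p | B p.1 p.2].

Definition dom_op (U V : Type) (B : U -> set V) : set U := [set x | B x !=set0].

Definition op_fun (U V : Type) (g : U -> V) : U -> set V := fun x => [set g x].

Definition op_add (U : Type) (V : zmodType) (B1 B2 : U -> set V) : U -> set V :=
  fun x => [set a + b | a in B1 x & b in B2 x].

Definition op_opp (U : Type) (V : zmodType) (B : U -> set V) : U -> set V :=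
  fun x => [set - a | a in B x].

(* The pairing is a parameter because monotonicity is needed on
   [Z * dual Z] as well as on [dual (dual Z) * dual Z]. *)
Definition monotone_for (U V : zmodType) (pairing : U -> V -> R)
    (G : set (U * V)) : Prop :=
  forall p q, G p -> G q -> 0 <= pairing (p.1 - q.1) (p.2 - q.2).

Definition maximally_monotone_for (U V : zmodType) (pairing : U -> V -> R)
    (G : set (U * V)) : Prop :=
  monotone_for pairing G /\
  forall H, monotone_for pairing H -> G `<=` H -> H = G.

Variable Z : normedModType R.
Implicit Type B : Z -> set (dual Z).

Definition maximally_monotone B : Prop :=
  maximally_monotone_for (fun z (zs : dual Z) => zs z) (gra B).

Definition linear_relation B : Prop :=
  gra B (0, 0) /\
  forall (a : R) x xs y ys, gra B (x, xs) -> gra B (y, ys) ->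
    gra B (a *: x + y, a *: xs + ys).

Definition skew_op B : Prop :=
  linear_relation B /\ forall x xs, gra B (x, xs) -> xs x = 0.

(* The dual of [Z * dual Z] is represented by [dual Z * dual (dual Z)]. *)
Definition annihilator (G : set (Z * dual Z)) : set (dual Z * dual (dual Z)) :=
  [set q : dual Z * dual (dual Z) |
    forall p, G p -> q.1 p.1 + q.2 p.2 = 0].

Definition adjoint B : dual (dual Z) -> set (dual Z) :=
  fun xss => [set xs : dual Z | annihilator (gra B) (xs, - xss)].

Lemma adjoint_op_fun (A : {linear Z -> dual Z}) (cA : continuous A) (z : Z) :
  adjoint (op_fun A) (bidual_emb z) = [set lin_adjoint cA z].
Proof.
apply/seteqP; split=> [xs h|_ -> [y ys]]; last first.
  by rewrite /gra/= => ->; rewrite subrr.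
apply: dualP => y; apply/eqP; rewrite -subr_eq0; apply/eqP.
exact: (h (y, A y)).
Qed.

Definition directed (I : Type) (le : I -> I -> Prop) : Prop :=
  [/\ inhabited I, forall i, le i i,
      forall i j k, le i j -> le j k -> le i k &
      forall i j, exists k, le i k /\ le j k].

Definition tail_filter (I : Type) (le : I -> I -> Prop) : set_system I :=
  [set S | exists i0, forall i, le i0 i -> S i].

(* [type_D], [type_BR] and [unique_bidual] state the properties themselves;
   they are meant for maximally monotone operators, which is not part of the
   definitions. *)
Definition type_D B : Prop :=
  forall (xss : dual (dual Z)) (xs : dual Z),
  (0 <= ereal_inf [set ((bidual_emb p.1 - xss) (p.2 - xs))%:E | p in gra B])%E ->
  exists (I : Type) (le : I -> I -> Prop) (a : I -> Z * dual Z),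
    [/\ directed le, range a `<=` gra B, bounded_set (range a),
        forall ys : dual Z, ys (a i).1 @[i --> tail_filter le] --> xss ys &
        (a i).2 @[i --> tail_filter le] --> xs].

Definition type_BR B : Prop :=
  forall (x : Z) (xs : dual Z) (alpha beta : R), 0 < alpha -> 0 < beta ->
  ((- (alpha * beta))%:E <
    ereal_inf [set ((xs - p.2) (x - p.1))%:E | p in gra B])%E ->
  exists b bs, [/\ gra B (b, bs), `|x - b| < alpha & `|xs - bs| < beta].

Definition unique_bidual B : Prop :=
  let bidual_pairing (zss : dual (dual Z)) (zs : dual Z) : R := zss zs in
  let G := [set (bidual_emb p.1, p.2) | p in gra B] in
  forall H1 H2 : set (dual (dual Z) * dual Z),
    maximally_monotone_for bidual_pairing H1 -> G `<=` H1 ->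
    maximally_monotone_for bidual_pairing H2 -> G `<=` H2 -> H1 = H2.

End Operators.

Section ConvexFunctions.
Variable R : realType.

Definition efdom (V : Type) (f : V -> \bar R) : set V :=
  [set x | f x \is a fin_num].

(* Functions into ]-oo, +oo] are functions into \bar R avoiding -oo. *)
Definition eproper (V : Type) (f : V -> \bar R) : Prop :=
  (forall x, f x != -oo%E) /\ efdom f !=set0.

Definition econvex (V : lmodType R) (f : V -> \bar R) : Prop :=
  forall (x y : V) (t : R), 0 < t -> t < 1 ->
    (f (t *: x + (1 - t) *: y)%R <= t%:E * f x + (1 - t)%:E * f y)%E.

Definition eindicator (V : Type) (C : set V) : V -> \bar R :=
  fun x => if x \in C then 0%E else +oo%E.

Variable Z : normedModType R.

Definition fenchel_conj (f : Z -> \bar R) : dual Z -> \bar R :=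
  fun zs => ereal_sup [set ((zs z)%:E - f z)%E | z in setT].

Definition subdifferential (f : Z -> \bar R) : Z -> set (dual Z) :=
  fun x => [set xs : dual Z | forall y, ((xs (y - x)%R)%:E + f x <= f y)%E].

Definition fitzpatrick (B : Z -> set (dual Z)) : Z * dual Z -> \bar R :=
  fun p => ereal_sup [set (a.2 p.1 + p.2 a.1 - a.2 a.1)%:E | a in gra B].

(* Same representation of the dual of [Z * dual Z] as in [annihilator]. *)
Definition fenchel_conj2 (H : Z * dual Z -> \bar R) :
    dual Z * dual (dual Z) -> \bar R :=
  fun q => ereal_sup [set ((q.1 p.1 + q.2 p.2)%:E - H p)%E | p in setT].

Definition BC_function (H : Z * dual Z -> \bar R) : Prop :=
  [/\ eproper H, econvex H &
      forall x xs, (H (x, xs) <= fenchel_conj2 H (xs, bidual_emb x))%E /\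
                   ((xs x)%:E <= H (x, xs))%E].

Definition inf_conv1 (F1 F2 : Z * dual Z -> \bar R) : Z * dual Z -> \bar R :=
  fun p => ereal_inf [set (F1 (u, p.2) + F2 (p.1 - u, p.2)%R)%E | u in setT].

Definition conic_hull (V : lmodType R) (D : set V) : set V :=
  \bigcup_(l in [set l : R | 0 < l]) [set l *: d | d in D].

Definition minkowski_sub (V : zmodType) (D E : set V) : set V :=
  [set d - e | d in D & e in E].

Definition closed_subspace (D : set Z) : Prop :=
  [/\ closed D, D 0 & forall (a : R) x y, D x -> D y -> D (a *: x + y)].

End ConvexFunctions.

(* Main.v *)
From HB Require Import structures.
Require Import Defs.
From mathcomp Require Import all_boot all_order all_algebra.
From mathcomp Require Import all_classical all_reals all_analysis.
From mathcomp Require Import lra ring.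
Import Order.TTheory GRing.Theory Num.Theory.
Import numFieldNormedType.Exports.

Local Open Scope classical_set_scope.
Local Open Scope ring_scope.

Set Implicit Arguments.
Unset Strict Implicit.
Unset Printing Implicit Defensive.

(** Polarising [A x x = e x ^+ 2] gives [A x y + A y x = 2 * e x * e y], so the
adjoint of [A] is [x |-> (2 * e x) *: e - A x] ([lin_adjointE]), and on the
kernel of [e] the operator [A] is skew.  Since [A] takes its values in the
canonical image of [X] it factors through a linear map [B : dual X -> X], and
the graph of [T] is [{(- B x, x) | e x = 0}].  Everything rests on [e] lying
outside [X]: a functional on [dual X] that vanishes on the kernel of [e] is a
multiple [r *: e], and if it comes from [X] then [r = 0].  Maximality of [T]
and the formula for its Fitzpatrick function follow at once
([skew_rel_orth]).

The failures of type (D) and of uniqueness come from explicit points of the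
bidual.  Along a bounded net whose second component converges in norm, the
pairing with the limit tends to 0; hence an operator is not of type (D) as
soon as one point of the bidual keeps a positive gap to its graph
([not_type_D]), and uniqueness fails as soon as two points related to the
graph are not related to each other ([not_unique_bidual]).  For [A] these
points are [(s *: w, t *: e)], where [w] vanishes on [X] and [w e = 1], with
gap at least [inf_r (r ^+ 2 - t * r + s * t)].  For [T] they are
[(- A u + r *: e, u)], with gap [e u * (r - e u)].  Taking [r = 2 * e u] gives
[lin_adjoint u] with gap [e u ^+ 2], which is large enough to survive the
addition of a subdifferential: pair it with an [e u ^+ 2 / 2]-approximate
subgradient of [f^**] at [lin_adjoint u] ([sum_not_type_D]).

The sum theorem is the long part.  Let [(z, zs)] be related to the graph of
[T + df], with [x0] in the domain of [T] and in the interior of that of [df].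
Testing near [x0], where subgradients are bounded, shows that
[v |-> v (z + B zs)] is bounded with respect to the norm of [B v]; an extension of
this functional yields [u] with [z = - B u] ([related_in_range]).  Then
[(u - v) (z - x) = - e u ^+ 2] for every [(x, v)] in the graph of [T], so with
[g := f - (zs - u)] the relation becomes [e u ^+ 2 <= b (x - z)] for all [x]
in the domain of [T] and [b] in [dg(x)]: the operator has disappeared.  To
exploit this on the subspace [D = dom T], approximate [z] by [y] in [D] and
minimise [g (x0 + s *: (y - x0)) + (s - 1) ^+ 2 / 2] over real [s].  The
minimiser carries a subgradient [b] with [b (y - x0) = 1 - s]
([prox_line]), bounded independently of [y], and the inequality becomes
[(1 - s) ^+ 2 + e u ^+ 2 <= K * `|y - z|].  Hence [e u = 0], and [z]
minimises [g] on [D] ([minimiser_on_subspace]).  A subgradient of [g] at [z]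
that vanishes on [D] then splits [zs] as an element of [T z + df(z)].

The analytic tools are Hahn-Banach for sublinear functionals, a sandwich
theorem derived from it, which produces affine minorants (hence
Fenchel-Moreau) and subgradients extending a given functional, and Baire's
theorem, which bounds [f] near an interior point of its domain. *)

(** * Hahn-Banach for sublinear functionals *)

(** Partial linear functionals are encoded by their graphs, so that the domain
need not be a type and Zorn's lemma applies to sets ordered by inclusion. *)
Definition linrel (R : realType) (V : lmodType R) (G : set (V * R^o)) : Prop :=
  G (0, 0) /\ forall a x r y s, G (x, r) -> G (y, s) -> G (a *: x + y, a * r + s).

Section HahnBanach.
Variables (R : realType) (V : lmodType R) (p : V -> R).
Hypothesis p_sub : forall x y, p (x + y) <= p x + p y.
Hypothesis p_hom : forall a x, 0 < a -> p (a *: x) = a * p x.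

(** Domination makes the relation single-valued: [p 0 = 0] bounds both
[r - s] and [s - r]. *)
Lemma linrel_fun (G : set (V * R^o)) x r s : linrel G ->
  (forall x r, G (x, r) -> r <= p x) -> G (x, r) -> G (x, s) -> r = s.
Proof.
move=> [G0 GD] Gp Gr Gs.
have p0 : p 0 = 0.
  have := @p_hom 2 0 ltac:(lra); rewrite scaler0; lra.
have := Gp _ _ (GD (-1) _ _ _ _ Gr Gs); have := Gp _ _ (GD (-1) _ _ _ _ Gs Gr).
by rewrite !scaleN1r !addNr p0; lra.
Qed.

Lemma linrelZ (G : set (V * R^o)) a x r : linrel G -> G (x, r) -> G (a *: x, a * r).
Proof. by move=> [G0 GD] Gx; have := GD a _ _ _ _ Gx G0; rewrite !addr0. Qed.

(** The value at [v] is the supremum of [s - p (y - v)] over the graph; by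
subadditivity every such number is below every [p (y + v) - s]. *)
Lemma hahn_banach_step (G : set (V * R^o)) v : linrel G ->
  (forall x r, G (x, r) -> r <= p x) ->
  exists H, [/\ linrel H, G `<=` H, forall x r, H (x, r) -> r <= p x &
             exists r, H (v, r)].
Proof.
move=> Gl Gp; have [G0 GD] := Gl.
pose L := [set q.2 - p (q.1 - v) | q in G].
have L0 : L !=set0 by exists (0 - p (0 - v)), (0, 0).
have Lub y r : G (y, r) -> ubound L (p (y + v) - r).
  move=> Gy _ [[x s] Gx <-] /=.
  have := Gp _ _ (GD 1 _ _ _ _ Gx Gy); have := p_sub (x - v) (y + v).
  by rewrite scale1r mul1r addrACA addNr addr0; lra.
pose r := sup L.
have hsL : has_sup L by split=> //; exists (p (0 + v) - 0); exact: Lub.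
have r_lb x s : G (x, s) -> s - p (x - v) <= r.
  by move=> Gx; apply: sup_upper_bound => //; exists (x, s).
have r_ub x s : G (x, s) -> r <= p (x + v) - s.
  by move=> Gx; apply: ge_sup => //; exact: Lub.
exists [set q | exists a y s, G (y, s) /\ q = (y + a *: v, s + a * r)]; split.
- split; first by exists 0, 0, 0; rewrite scale0r mul0r !addr0.
  move=> a x1 r1 x2 r2 [b1 [y1 [s1 [G1 [-> ->]]]]] [b2 [y2 [s2 [G2 [-> ->]]]]].
  exists (a * b1 + b2), (a *: y1 + y2), (a * s1 + s2); split; first exact: GD.
  congr pair; last by ring.
  by rewrite scalerDr scalerDl scalerA addrACA.
- by move=> [x s] Gx; exists 0, x, s; rewrite scale0r mul0r !addr0.
- move=> _ _ [a [y [s [Gy [-> ->]]]]].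
  have [a0|a0|->] := ltgtP a 0; last by rewrite scale0r mul0r !addr0; exact: Gp.
  + have b0 : 0 < - a by lra.
    have bN0 : - a != 0 by rewrite gt_eqF.
    have := r_lb _ _ (linrelZ (- a)^-1 Gl Gy).
    have -> : (- a)^-1 *: y - v = (- a)^-1 *: (y + a *: v).
      by rewrite scalerDr scalerA invrN mulNr mulVf ?lt_eqF// scaleN1r.
    rewrite p_hom ?invr_gt0// -mulrBr mulrC ler_pdivrMr//; lra.
  + have := r_ub _ _ (linrelZ a^-1 Gl Gy).
    have -> : a^-1 *: y + v = a^-1 *: (y + a *: v).
      by rewrite scalerDr scalerA mulVf ?gt_eqF// scale1r.
    rewrite p_hom ?invr_gt0// -mulrBr mulrC ler_pdivlMr//; lra.
- by exists r, 1, 0, 0; rewrite scale1r mul1r !add0r.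
Qed.

(** In the application of Zorn's lemma a set [S] stands for the relation
[S `|` G]: this makes the empty chain harmless. *)
Theorem hahn_banach (G : set (V * R^o)) : linrel G ->
  (forall x r, G (x, r) -> r <= p x) ->
  exists phi : V -> R^o, [/\ linear phi, forall x r, G (x, r) -> phi x = r &
                          forall x, phi x <= p x].
Proof.
move=> Gl Gp.
pose good (S : set (V * R^o)) :=
  linrel (S `|` G) /\ forall x r, (S `|` G) (x, r) -> r <= p x.
have [M [[Ml Mp] Mmax]] : exists A, good A /\ forall B, A `<` B -> ~ good B.
  apply: Zorn_bigcup => F FP Ftot.
  set U := \bigcup_(X in F) X.
  have U2 q1 q2 : (U `|` G) q1 -> (U `|` G) q2 ->
      exists S, [/\ good S, S `<=` U, (S `|` G) q1 & (S `|` G) q2].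
    have G0 : good set0 by rewrite /good set0U.
    have FU S : F S -> S `<=` U by move=> FS q Sq; exists S.
    move=> [[S1 FS1 h1]|h1] [[S2 FS2 h2]|h2].
    - have [S12|S21] := Ftot _ _ FS1 FS2.
      + by exists S2; split; [exact: FP|exact: FU|left; exact: S12|left].
      + by exists S1; split; [exact: FP|exact: FU|left|left; exact: S21].
    - by exists S1; split; [exact: FP|exact: FU|left|right].
    - by exists S2; split; [exact: FP|exact: FU|right|left].
    - by exists set0; split => //; right.
  split; first split.
  + by right; case: Gl.
  + move=> a x r y s Ux Uy.
    have [S [[[_ SD] _] SU Sx Sy]] := U2 _ _ Ux Uy.
    by apply: (setSU SU); exact: SD.
  + by move=> x r Ux; have [S [[_ Sp] _ Sx _]] := U2 _ _ Ux Ux; exact: Sp.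
have total v : exists r, (M `|` G) (v, r).
  have [H [Hl GH Hp [r Hr]]] := hahn_banach_step v Ml Mp.
  have MH : M `<=` H by move=> q Mq; apply: GH; left.
  exists r; left; apply: contrapT => nMr; apply: (Mmax H).
    by split=> // HM; apply: nMr; exact: HM.
  have -> // : good H = (linrel H /\ forall x r, H (x, r) -> r <= p x).
  by rewrite /good setUidl// => q Gq; apply: GH; right.
have [phi phiP] := choice total.
exists phi; split.
- move=> a x y; apply: (linrel_fun Ml Mp); first exact: phiP.
  by apply: Ml.2.
- by move=> x r Gx; apply: (linrel_fun Ml Mp); [exact: phiP|right].
- by move=> x; exact: Mp.
Qed.

End HahnBanach.

(** * Continuous functionals and the embedding in the bidual *)

Section Functionals.
Variables (R : realType) (Z : normedModType R).
Implicit Types (phi psi e u : dual Z) (G : set (Z * R^o)).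

Lemma dualZ phi a x : phi (a *: x) = a * phi x.
Proof. by rewrite linearZ. Qed.

Lemma dualD phi x y : phi (x + y) = phi x + phi y.
Proof. by rewrite linearD. Qed.

Lemma dualN phi x : phi (- x) = - phi x.
Proof. by rewrite linearN. Qed.

Lemma dualB phi x y : phi (x - y) = phi x - phi y.
Proof. by rewrite linearB. Qed.

Lemma dual0 phi : phi 0 = 0.
Proof. by rewrite linear0. Qed.

Lemma dualZE (a : R) phi x : dual_fun (a *: phi) x = a * phi x.
Proof. by []. Qed.

Lemma dualBE phi psi x : dual_fun (phi - psi) x = phi x - psi x.
Proof. by []. Qed.

Lemma dualDE phi psi x : dual_fun (phi + psi) x = phi x + psi x.
Proof. by []. Qed.

Lemma dualNE phi x : dual_fun (- phi) x = - phi x.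
Proof. by []. Qed.

Lemma dual_normP phi x : `|phi x| <= `|phi| * `|x|.
Proof. exact: dual_norm_le. Qed.

Lemma dual_normP_le phi M : 0 <= M -> (forall x, `|phi x| <= M * `|x|) -> `|phi| <= M.
Proof.
move=> M0 h; apply: dual_norm_ub => x x1; apply: (le_trans (h x)).
by rewrite -[leRHS]mulr1 ler_wpM2l.
Qed.

Lemma dual_hahn_banach (p : Z -> R) n G :
  (forall x y, p (x + y) <= p x + p y) ->
  (forall a x, 0 < a -> p (a *: x) = a * p x) ->
  (forall x, p x <= n * `|x|) -> linrel G -> (forall x r, G (x, r) -> r <= p x) ->
  exists phi, (forall x r, G (x, r) -> phi x = r) /\ forall x, phi x <= p x.
Proof.
move=> p_sub p_hom pn Gl Gp.
have [phi [phil phiG phip]] := hahn_banach p_sub p_hom Gl Gp.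
have phiN x : phi (- x) = - phi x.
  by have := phil (-1) x 0; rewrite !scaleN1r addr0 => ->;
    have := phil (-1) 0 0; rewrite scaler0 addr0 scaleN1r => ->; rewrite addNr addr0.
have hb : phi \in @cont_linear R Z.
  apply: (@cont_linear_of_bound _ _ _ n) => // x; rewrite ler_norml.
  have := le_trans (phip x) (pn x); have := le_trans (phip (- x)) (pn (- x)).
  by rewrite phiN normrN; lra.
by exists (Dual hb).
Qed.

Lemma norm_hahn_banach n G : 0 <= n -> linrel G ->
  (forall x r, G (x, r) -> r <= n * `|x|) ->
  exists phi, (forall x r, G (x, r) -> phi x = r) /\ forall x, `|phi x| <= n * `|x|.
Proof.
move=> n0 Gl Gn.
have [|||phi [phiG phin]] := @dual_hahn_banach (fun x => n * `|x|) n G _ _ _ Gl Gn.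
- by move=> x y; rewrite -mulrDr ler_wpM2l// ler_normD.
- by move=> a x a0; rewrite normrZ gtr0_norm// mulrCA.
- by [].
exists phi; split => // x; rewrite ler_norml phin andbT.
by have := phin (- x); rewrite linearN normrN; lra.
Qed.

Lemma norming x : exists phi, phi x = `|x| /\ forall y, `|phi y| <= `|y|.
Proof.
have [||phi [h1 h2]] := @norm_hahn_banach 1 [set q | exists a, q = (a *: x, a * `|x|)] ler01.
- split; first by exists 0; rewrite scale0r mul0r.
  move=> a _ _ _ _ [b [-> ->]] [c [-> ->]]; exists (a * b + c).
  by rewrite scalerDl scalerA mulrDl mulrA.
- by move=> _ _ [a [-> ->]]; rewrite mul1r normrZ ler_wpM2r// ler_norm.
exists phi; split; first by apply: h1; exists 1; rewrite scale1r mul1r.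
by move=> y; rewrite -[leRHS]mul1r.
Qed.

(** The bipolar theorem for a subspace.  If all of [L] is at distance at least
[eta] from [z], then [y + s *: z |-> s] is bounded by [eta^-1] times the norm,
and its extension vanishes on [L] but not at [z]. *)
Lemma annihilator_approx (L : set Z) z :
  L 0 -> (forall a x y, L x -> L y -> L (a *: x + y)) ->
  (forall phi, (forall x, L x -> phi x = 0) -> phi z = 0) ->
  forall eta, 0 < eta -> exists2 y, L y & `|z - y| < eta.
Proof.
move=> L0 LD Lz eta eta0; apply: contrapT => far.
have dist y : L y -> eta <= `|z - y|.
  by move=> Ly; rewrite leNgt; apply/negP => h; apply: far; exists y.
have [|||phi [h1 _]] := @norm_hahn_banach eta^-1
    [set q | exists y s, L y /\ q = (y + s *: z, s)].
- by rewrite invr_ge0 ltW.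
- split; first by exists 0, 0; rewrite scale0r addr0.
  move=> a _ _ _ _ [y1 [s1 [L1 [-> ->]]]] [y2 [s2 [L2 [-> ->]]]].
  exists (a *: y1 + y2), (a * s1 + s2); split; first exact: LD.
  by rewrite scalerDr scalerDl scalerA addrACA.
- move=> _ _ [y [s [Ly [-> ->]]]]; rewrite mulrC ler_pdivlMr//.
  have [s0|s0] := leP s 0.
    by apply: le_trans (normr_ge0 _); rewrite mulr_le0_ge0// ltW.
  have -> : y + s *: z = s *: (z - - s^-1 *: y).
    by rewrite scaleNr opprK scalerDr scalerA mulfV ?gt_eqF// scale1r addrC.
  rewrite normrZ gtr0_norm// ler_pM2l//; apply: dist.
  by rewrite -[_ *: _]addr0; apply: LD.
have : phi z = 0.
  apply: Lz => x Lx; apply: h1; exists x, 0; by rewrite scale0r addr0.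
have -> : phi z = 1 by apply: h1; exists 0, 1; rewrite scale1r add0r.
by move/eqP; rewrite oner_eq0.
Qed.

Lemma dual_multiple e u : (forall x, e x = 0 -> u x = 0) -> exists r : R, u = r *: e.
Proof.
move=> ker; have [[x0 ex0]|e0] := pselect (exists x, e x != 0).
  exists (u x0 / e x0); apply: dualP => x.
  have := ker (x - (e x / e x0) *: x0).
  rewrite !dualB !dualZ divfK// subrr => /(_ erefl) /eqP.
  by rewrite subr_eq0 dualZE => /eqP ->; field.
exists 0; apply: dualP => x; rewrite scale0r; apply: ker.
by apply/eqP; apply: contrapT => /negP h; apply: e0; exists x.
Qed.

End Functionals.

(** Homogeneity.  Rescaling by [rho / (`|x| + eta)] instead of [rho / `|x|] avoids
the case [x = 0]; then [eta] tends to 0. *)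
Lemma linrel_bound (R : realType) (Z : normedModType R) (G : set (Z * R^o)) (rho C : R) :
  0 < rho -> linrel G -> (forall x r, G (x, r) -> `|x| <= rho -> r <= C) ->
  forall x r, G (x, r) -> r <= C / rho * `|x|.
Proof.
move=> rho0 Gl GC x r Gx.
have C0 : 0 <= C by apply: (GC 0 0 Gl.1); rewrite normr0 ltW.
apply/ler_addgt0Pl => eps eps0.
pose eta := eps * rho / (C + 1).
have C1 : 0 < C + 1 by lra.
have eta0 : 0 < eta by rewrite divr_gt0// mulr_gt0.
have k0 : 0 < `|x| + eta by rewrite ltr_wpDl.
have := GC _ _ (linrelZ (rho / (`|x| + eta)) Gl Gx).
have -> : `|(rho / (`|x| + eta)) *: x| <= rho.
  rewrite normrZ gtr0_norm ?divr_gt0// mulrAC ler_pdivrMr// ler_pM2l//; lra.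
move=> /(_ isT) h.
have {h} : r <= C / rho * (`|x| + eta).
  rewrite mulrAC ler_pdivlMr// mulrC -ler_pdivrMr//.
  by move: h; rewrite mulrAC.
have : C / rho * eta <= eps.
  have -> : C / rho * eta = eps * (C / (C + 1)).
    by rewrite /eta; field; rewrite !gt_eqF.
  rewrite -[leRHS]mulr1 ler_wpM2l ?ltW// ltr_pdivrMr//; lra.
by rewrite mulrDr; lra.
Qed.

Lemma dual_bound (R : realType) (Z : normedModType R) (phi : dual Z) (rho C : R) :
  0 < rho -> (forall x, `|x| <= rho -> phi x <= C) ->
  forall x, `|phi x| <= C / rho * `|x|.
Proof.
move=> rho0 h x.
have Gl : linrel [set p : Z * R^o | p.2 = phi p.1].
  by split=> [|a y r z s /= -> ->]; rewrite /= ?dual0// dualD dualZ.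
have H y : phi y <= C / rho * `|y|.
  by apply: (linrel_bound rho0 Gl) => // w r /= ->; exact: h.
by rewrite ler_norml H andbT; have := H (- x); rewrite dualN normrN; lra.
Qed.

Section Embedding.
Variables (R : realType) (Z : normedModType R).

Lemma emb_linear (a : R) (x y : Z) :
  bidual_emb (a *: x + y) = a *: bidual_emb x + bidual_emb y :> dual (dual Z).
Proof. by apply: dualP => phi /=; rewrite linearP. Qed.

HB.instance Definition _ :=
  GRing.isLinear.Build R Z (dual (dual Z)) *:%R (@bidual_emb R Z) emb_linear.

Lemma emb_norm (x : Z) : `|bidual_emb x| = `|x|.
Proof.
apply/eqP; rewrite eq_le; apply/andP; split.
  by apply: dual_normP_le => // phi /=; rewrite mulrC; exact: dual_normP.
have [phi [phix phin]] := norming x.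
have phi1 : `|phi| <= 1 by apply: dual_normP_le => // y; rewrite mul1r.
have := dual_normP (bidual_emb x) phi; rewrite /= phix normr_id => h.
by apply: (le_trans h); rewrite -[leRHS]mulr1 ler_wpM2l.
Qed.

Lemma emb_inj : injective (@bidual_emb R Z).
Proof.
move=> x y /eqP; rewrite -subr_eq0 -linearB -normr_eq0 emb_norm normr_eq0 subr_eq0.
by move/eqP.
Qed.

End Embedding.

(** The embedding is isometric and [X] is complete, so approximants of [e] in
[X] form a Cauchy sequence whose limit represents [e]. *)
Lemma emb_range_closed (R : realType) (X : completeNormedModType R) (e : dual (dual X)) :
  (forall eta, 0 < eta -> exists2 y, range (@bidual_emb R X) y & `|e - y| < eta) ->
  range (@bidual_emb R X) e.
Proof.
move=> h.
have /choice[x xP] n : exists x : X, `|e - bidual_emb x| < n.+1%:R^-1.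
  by have [|_ [x _ <-] hx] := h n.+1%:R^-1; [rewrite invr_gt0|exists x].
have close n m : (n <= m)%N -> `|x n - x m| < 2 * n.+1%:R^-1.
  move=> nm; rewrite -emb_norm linearB /=.
  have := ler_distD e (bidual_emb (x n)) (bidual_emb (x m)).
  have := xP n; have := xP m; rewrite (distrC e (bidual_emb (x n))).
  have : m.+1%:R^-1 <= n.+1%:R^-1 :> R by rewrite lef_pV2 ?posrE// ler_nat.
  move: (m.+1%:R^-1 : R) (n.+1%:R^-1 : R) => a b.
  by lra.
have small (eps : R) : 0 < eps -> exists n, 2 * n.+1%:R^-1 < eps.
  move=> eps0; exists (Num.bound (2 / eps)).
  rewrite ltr_pdivrMr// mulrC -ltr_pdivrMr//.
  by apply: lt_trans (archi_boundP _) _; rewrite ?ltr_nat// divr_ge0// ltW.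
have : cvg (x @ \oo).
  apply/cauchy_cvgP; apply: cauchy_exP => eps eps0.
  have [n hn] := small _ eps0; exists (x n); exists n => // m /= nm.
  by rewrite -ball_normE /=; apply: lt_trans hn; exact: close.
move: (lim _) => y xy.
exists y => //; apply/eqP; rewrite eq_sym -subr_eq0 -normr_le0.
apply/ler_addgt0Pl => eps eps0; rewrite addr0.
have eps2 : 0 < eps / 2 by lra.
have [n hn] := small _ eps2.
have /cvgrPdist_lt/(_ _ eps2)[m _ hm] := xy.
have {}hm := hm _ (leq_maxr n m).
have := xP (maxn n m); have : (maxn n m).+1%:R^-1 <= n.+1%:R^-1 :> R.
  by rewrite lef_pV2 ?posrE// ler_nat ltnS leq_maxl.
have n0 : 0 < n.+1%:R^-1 :> R by rewrite invr_gt0.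
have := ler_distD (bidual_emb (x (maxn n m))) e (bidual_emb y).
rewrite -linearB /= emb_norm (distrC _ y); move: hm hn n0 => /=.
by move: (_^-1 : R) (n.+1%:R^-1 : R) => a b; lra.
Qed.

(** * A sandwich theorem *)

Section Sandwich.
Variables (R : realType) (Z : normedModType R).

Definition convexset (E : set (Z * R^o)) := forall x y r s t, 0 < t -> t < 1 ->
  E (x, r) -> E (y, s) -> E (t *: x + (1 - t) *: y, t * r + (1 - t) * s).

(** The functional [p x = inf (t * s + n * `|x - t *: w|)], over [t >= 0] and [(w, s)] in
[E], is sublinear, lies below [n * `|x|] and, at [w], below [s] for every
[(w, s)] in [E]; the last two hypotheses say that it dominates [G].  Dominating
[phi] by [p] therefore gives continuity and the bound on [E] at once. *)
Lemma sandwich (E G : set (Z * R^o)) n : 0 <= n -> convexset E -> linrel G ->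
  (forall x r, G (x, r) -> r <= n * `|x|) ->
  (forall x r w s t, G (x, r) -> E (w, s) -> 0 < t -> r <= t * s + n * `|x - t *: w|) ->
  exists phi : dual Z, (forall x r, G (x, r) -> phi x = r) /\
                       forall w s, E (w, s) -> phi w <= s.
Proof.
move=> n0 Ec Gl Gn GE.
(* The convex cone generated by [E], with its apex. *)
pose C : set (Z * R^o) := [set q | q = (0, 0) \/
  exists t w s, [/\ 0 < t, E (w, s) & q = (t *: w, t * s)]].
have C_add q1 q2 : C q1 -> C q2 -> C (q1 + q2).
  move=> [->|[t1 [w1 [s1 [t10 E1 ->]]]]]; first by rewrite add0r.
  move=> [->|[t2 [w2 [s2 [t20 E2 ->]]]]].
    by rewrite addr0; right; exists t1, w1, s1.
  right; exists (t1 + t2).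
  have t12 : 0 < t1 + t2 by lra.
  have t12n : t1 + t2 != 0 by rewrite gt_eqF.
  have e1 : 1 - t1 / (t1 + t2) = t2 / (t1 + t2) by field.
  exists (t1 / (t1 + t2) *: w1 + (1 - t1 / (t1 + t2)) *: w2).
  exists (t1 / (t1 + t2) * s1 + (1 - t1 / (t1 + t2)) * s2); split => //.
    apply: Ec => //; first by rewrite divr_gt0.
    by rewrite ltr_pdivrMr// mul1r; lra.
  rewrite e1; congr pair; last by rewrite /=; field.
  by rewrite scalerDr !scalerA !(mulrC (t1 + t2)) !divfK.
have C_hom a q : 0 < a -> C q -> C (a *: q).
  move=> a0 [->|[t [w [s [t0 Ew ->]]]]]; first by rewrite scaler0; left.
  right; exists (a * t), w, s; split => //; first by rewrite mulr_gt0.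
  by congr pair; rewrite ?scalerA// [RHS]mulrA.
have GC x r q : G (x, r) -> C q -> r <= q.2 + n * `|x - q.1|.
  move=> Gx [->|[t [w [s [t0 Ew ->]]]]]; first by rewrite subr0 add0r; exact: Gn.
  exact: GE.
pose L x : set R := [set q.2 + n * `|x - q.1| | q in C].
pose p x : R := inf (L x).
have Llb x : lbound (L x) (- (n * `|x|)).
  move=> _ [q Cq <-]; have := GC 0 0 q Gl.1 Cq.
  have : n * `|0 - q.1| <= n * `|x| + n * `|x - q.1|.
    by rewrite -mulrDr ler_wpM2l// -(normrN x) -[0](addNr x) -addrA ler_normD.
  lra.
have pE x q : C q -> p x <= q.2 + n * `|x - q.1|.
  by move=> Cq; apply: inf_lbound; [exists (- (n * `|x|)); exact: Llb|exists q].
have C0 : C (0, 0) by left.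
have plb x r : (forall q, C q -> r <= q.2 + n * `|x - q.1|) -> r <= p x.
  move=> h; apply: lb_le_inf; first by exists (0 + n * `|x - 0|), (0, 0).
  by move=> _ [q Cq <-]; exact: h.
have pn x : p x <= n * `|x|.
  by have := pE x _ C0; rewrite /= subr0 add0r.
have p_hom1 a x : 0 < a -> p (a *: x) <= a * p x.
  move=> a0; rewrite mulrC -ler_pdivrMr//; apply: plb => q Cq.
  rewrite ler_pdivrMr//; have := pE (a *: x) _ (C_hom _ _ a0 Cq).
  rewrite /= -scalerBr normrZ gtr0_norm// => /le_trans; apply.
  by rewrite /GRing.scale /=; lra.
have p_sub x y : p (x + y) <= p x + p y.
  rewrite -lerBlDl; apply: (plb _ _) => q2 Cq2.
  rewrite lerBlDl -lerBlDr; apply: plb => q1 Cq1; rewrite lerBlDr.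
  have := pE (x + y) _ (C_add _ _ Cq1 Cq2).
  have : n * `|x + y - (q1 + q2).1| <= n * `|x - q1.1| + n * `|y - q2.1|.
    by rewrite -mulrDr ler_wpM2l// opprD addrACA ler_normD.
  rewrite /=; lra.
have p_hom a x : 0 < a -> p (a *: x) = a * p x.
  move=> a0; apply/eqP; rewrite eq_le p_hom1//=.
  have ai : 0 < a^-1 by rewrite invr_gt0.
  have := p_hom1 _ (a *: x) ai; rewrite scalerA mulVf ?gt_eqF// scale1r.
  by rewrite mulrC ler_pdivlMr// mulrC.
have Gp x r : G (x, r) -> r <= p x by move=> Gx; apply: plb => q; exact: GC.
have [phi [phiG phip]] := dual_hahn_banach p_sub p_hom pn Gl Gp.
exists phi; split => // w s Ew; apply: (le_trans (phip w)).
have := pE w (w, s); rewrite /= subrr normr0 mulr0 addr0; apply.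
by right; exists 1, w, s; rewrite scale1r mul1r.
Qed.

End Sandwich.

(** * Extended reals and convexity *)

(** Scaling: if [l v] were not 0, then [l (a *: v)] would be unbounded below. *)
Lemma linear_bounded_below (R : realType) (V : lmodType R) (l : V -> R) (P : V -> Prop) (c : R) :
  (forall a (v : V), P v -> P (a *: v)) -> (forall a (v : V), l (a *: v) = a * l v) ->
  (forall v : V, P v -> c <= l v) -> forall v : V, P v -> l v = 0.
Proof.
move=> PZ lZ h v Pv; apply/eqP; apply: contrapT => /negP lv.
have := h _ (PZ ((c - 1) / l v) _ Pv); rewrite lZ divfK// lerBrDr gerDl.
by rewrite ler10.
Qed.

Lemma ereal_between (R : realType) (r : R) (k : \bar R) : (r%:E < k)%E ->
  exists2 a : R, r < a & (a%:E < k)%E.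
Proof.
case: k => [t| |]//; rewrite ?lte_fin => rt.
  by exists ((r + t) / 2); rewrite ?lte_fin; lra.
by exists (r + 1); [rewrite ltrDl|rewrite ltry].
Qed.

Lemma lt_adde_split (R : realType) (r : R) (a b : \bar R) : a != -oo%E -> b != -oo%E ->
  (r%:E < a + b)%E -> exists r1 r2, [/\ r = r1 + r2, (r1%:E < a)%E & (r2%:E < b)%E].
Proof.
case: a => [a| |]// _; case: b => [b| |]// _; rewrite ?lte_fin => h.
- by exists (a - (a + b - r) / 2), (b - (a + b - r) / 2); rewrite !lte_fin; split; lra.
- by exists (a - 1), (r - (a - 1)); rewrite lte_fin ltry; split => //; lra.
- by exists (r - (b - 1)), (b - 1); rewrite lte_fin ltry; split => //; lra.
- by exists r, 0; rewrite !ltry addr0.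
Qed.

Lemma le_lt_ereal (R : realType) (a b : \bar R) :
  (forall r : R, (r%:E < a)%E -> (r%:E <= b)%E) -> (a <= b)%E.
Proof.
move=> h; rewrite leNgt; apply/negP; case: b h => [b| |] h.
- by move=> /ereal_between[r br /h]; rewrite lee_fin leNgt br.
- by rewrite ltNge leey.
- case: a h => [a| |] h //.
    by have := h (a - 1); rewrite lte_fin ltrBlDr ltrDl ltr01 => /(_ isT).
  by have := h 0; rewrite ltry => /(_ isT).
Qed.

Lemma econvex_of_le (R : realType) (V : lmodType R) (k : V -> \bar R) :
  (forall x, k x != -oo%E) ->
  (forall x y (r s t : R), 0 < t -> t < 1 -> k x = r%:E -> k y = s%:E ->
    (k (t *: x + (1 - t) *: y)%R <= (t * r + (1 - t) * s)%R%:E)%E) -> econvex k.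
Proof.
move=> kN h x y t t0 t1; have t1' : 0 < 1 - t by lra.
have := h x y; have := kN x; have := kN y.
case: (k y) => [s| |]//; case: (k x) => [r| |]// _ _ h'.
- by have := h' r s t t0 t1 erefl erefl; rewrite EFinD !EFinM.
- by rewrite gt0_muley ?lte_fin// addye// leey.
- by rewrite [in X in (_ <= _ + X)%E]gt0_muley ?lte_fin// addey// leey.
- by rewrite !gt0_muley ?lte_fin// leey.
Qed.

(** * Affine minorants and subgradients of convex functions *)

Section ConvexFunctions.
Variables (R : realType) (Z : normedModType R) (f : Z -> \bar R).
Hypothesis fconv : econvex f.

Lemma econvex_le x y (r s t : R) : 0 < t -> t < 1 ->
  (f x <= r%:E)%E -> (f y <= s%:E)%E ->
  (f (t *: x + (1 - t) *: y)%R <= (t * r + (1 - t) * s)%R%:E)%E.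
Proof.
move=> t0 t1 fx fy; apply: (le_trans (fconv x y t0 t1)).
by rewrite (EFinD (t * r)) !EFinM; apply: leeD; apply: lee_wpmul2l => //; rewrite lee_fin; lra.
Qed.

(** Extended-real inequalities on [f] are thus reduced to real ones on its
epigraph, where linear arithmetic applies. *)
Lemma ge_epigraph (k : \bar R) (r : R) :
  (forall s, (k <= s%:E)%E -> r <= s) -> (r%:E <= k)%E.
Proof.
case: k => [s|_|h] /=; first by move=> /(_ s (lexx _)); rewrite lee_fin.
  by rewrite leey.
have : r <= r - 1 by apply: h; rewrite leNye.
by rewrite lerBrDr gerDl ler10.
Qed.

Lemma epigraph_convexset x0 (c : R) :
  convexset [set q : Z * R^o | (f (x0 + q.1)%R <= (c + q.2)%R%:E)%E].
Proof.
move=> x y r s t t0 t1 /= fx fy.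
have := econvex_le t0 t1 fx fy.
suff <- : x0 + (t *: x + (1 - t) *: y) = t *: (x0 + x) + (1 - t) *: (x0 + y).
  by move/le_trans; apply; rewrite lee_fin; lra.
by rewrite !scalerDr addrACA -scalerDl subrKC scale1r.
Qed.

Lemma linrel0 : linrel [set q : Z * R^o | q = (0, 0)].
Proof. by split=> // a x r y s [-> ->] [-> ->]; rewrite scaler0 mulr0 !addr0. Qed.

(** The bound of [f] near [x0] supplies the slope [n = (M - c) / delta] of the
sandwich theorem.  Given [w] in the domain and [h := x / t - w], the
convex combination of [x0 + w] with the point [x0 + (delta / k) *: h], at which
[f <= M], is [x0] plus a multiple of [x], where the hypothesis on [G] applies. *)
Lemma convex_extension x0 (delta M c : R) (G : set (Z * R^o)) : 0 < delta ->
  (forall h, `|h| <= delta -> (f (x0 + h)%R <= M%:E)%E) ->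
  linrel G ->
  (forall x r s, G (x, r) -> (f (x0 + x)%R <= s%:E)%E -> c + r <= s) ->
  exists phi : dual Z, (forall x r, G (x, r) -> phi x = r) /\
                       forall w, ((c + phi w)%R%:E <= f (x0 + w)%R)%E.
Proof.
move=> d0 fM Gl Gc.
have cM : c <= M.
  rewrite -[leLHS]addr0; apply: (Gc 0); first exact: Gl.1.
  by apply: fM; rewrite normr0 ltW.
pose n := (M - c) / delta.
have n0 : 0 <= n by rewrite divr_ge0 ?subr_ge0// ltW.
pose E := [set q : Z * R^o | (f (x0 + q.1)%R <= (c + q.2)%R%:E)%E].
have GE x r w s t : G (x, r) -> E (w, s) -> 0 < t -> r <= t * s + n * `|x - t *: w|.
  move=> Gx Ew t0; apply/ler_addgt0Pl => eps eps0.
  pose h := t^-1 *: x - w.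
  have -> : x - t *: w = t *: h by rewrite scalerBr scalerA mulfV ?gt_eqF// scale1r.
  rewrite normrZ gtr0_norm//.
  (* Strictly larger than [`|h|], in case [h = 0]. *)
  pose k := `|h| + eps / (t * (n + 1)).
  have tn0 : 0 < t * (n + 1) by rewrite mulr_gt0//; lra.
  have k0 : 0 < k by rewrite ltr_wpDl// divr_gt0.
  have kd : 0 < k + delta by lra.
  pose l := delta / (k + delta).
  have l0 : 0 < l by rewrite divr_gt0.
  have l1 : l < 1 by rewrite ltr_pdivrMr// mul1r; lra.
  have fh : (f (x0 + (delta / k) *: h)%R <= M%:E)%E.
    apply: fM; rewrite normrZ gtr0_norm ?divr_gt0//.
    rewrite mulrAC ler_pdivrMr// ler_pM2l//.
    by rewrite lerDl divr_ge0// ltW.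
  have := econvex_le l0 l1 Ew fh.
  have -> : l *: (x0 + w) + (1 - l) *: (x0 + (delta / k) *: h) = x0 + (l / t) *: x.
    rewrite !scalerDr addrACA -scalerDl subrKC scale1r; congr (_ + _).
    rewrite !scalerA.
    have -> : (1 - l) * (delta / k) = l by rewrite /l; field; rewrite !gt_eqF.
    by rewrite scalerN addrC subrK.
  move=> /(Gc _ _ _ (linrelZ (l / t) Gl Gx)) hh.
  have rt : r / t <= s + k * n.
    rewrite -(ler_pM2l l0) mulrDr.
    have -> : l * (k * n) = (1 - l) * (M - c).
      by rewrite /l /n; field; rewrite !gt_eqF.
    move: hh; rewrite /= -mulrA (mulrC t^-1).
    by move: (r / t : R) => u; lra.
  move: rt; rewrite ler_pdivrMr// => rt.
  have e1 : t * (k * n) = n * (t * `|h|) + eps * (n / (n + 1)).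
    by rewrite /k; field; rewrite !gt_eqF//; lra.
  have : eps * (n / (n + 1)) <= eps.
    rewrite -[leRHS]mulr1 ler_wpM2l ?ltW// ltr_pdivrMr; lra.
  lra.
have Gn x r : G (x, r) -> r <= n * `|x|.
  move=> Gx; apply/ler_addgt0Pl => eps eps0.
  pose t := eps / (M - c + 1).
  have Mc : 0 < M - c + 1 by lra.
  have t0 : 0 < t by rewrite divr_gt0.
  have := GE x r 0 (M - c) t Gx _ t0.
  rewrite scaler0 subr0 => /(_ _)/le_trans; apply.
    by rewrite /E /= subrKC; apply: fM; rewrite normr0 ltW.
  by rewrite lerD2r /t mulrAC ler_pdivrMr// ler_wpM2l ?ltW//; lra.
have [phi [h1 h2]] := sandwich n0 (@epigraph_convexset x0 c) Gl Gn GE.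
exists phi; split=> // w; apply: ge_epigraph => s fs.
by have := h2 w (s - c); rewrite /= subrKC => /(_ fs); lra.
Qed.

Lemma subdifferentiable x (delta M : R) : 0 < delta ->
  (forall h, `|h| <= delta -> (f (x + h)%R <= M%:E)%E) -> f x != -oo%E ->
  subdifferential f x !=set0.
Proof.
move=> d0 fM fxN.
have fx : f x \is a fin_num.
  rewrite fin_numE fxN/=; apply/eqP => fx.
  by have := fM 0; rewrite normr0 addr0 fx => /(_ (ltW d0)); rewrite leye_eq.
have [|phi [_ phiP]] := @convex_extension x delta M (fine (f x)) _ d0 fM linrel0.
  by move=> _ _ s [-> ->]; rewrite !addr0 -{1}(fineK fx) lee_fin.
exists phi => y; have := phiP (y - x).
by rewrite subrKC EFinD fineK// addeC.
Qed.

End ConvexFunctions.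

Section LowerSemicontinuous.
Variables (R : realType) (Z : normedModType R) (f : Z -> \bar R).
Hypotheses (fproper : eproper f) (flsc : lower_semicontinuous f) (fconv : econvex f).

Lemma lsc_ball x (r : R) : (r%:E < f x)%E ->
  exists2 rho : R, 0 < rho & forall y, `|y - x| < rho -> (r%:E < f y)%E.
Proof.
move=> /flsc[V /nbhs_ballP[rho /= rho0 rhoV] VP]; exists rho => // y yx.
by apply/VP/rhoV; rewrite -ball_normE /= distrC.
Qed.

(** Near a point [x1] of the domain [f] is bounded below by semicontinuity; a
point [y] further away is compared, by convexity, with the point of the
segment from [x1] to [y] at distance [rho / 2] from [x1]. *)
Lemma lsc_convex_lower_bound : exists x1 c n,
  0 <= n /\ forall y s, (f y <= s%:E)%E -> c - n * `|y - x1| <= s.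
Proof.
have [fN [x1 fx1]] := fproper.
pose a := fine (f x1); have fa : f x1 = a%:E by rewrite fineK.
have [|rho rho0 h] := @lsc_ball x1 (a - 1); first by rewrite fa lte_fin; lra.
exists x1, (a - 1), (2 / rho); split; first by rewrite divr_ge0// ltW.
move=> y s fy.
have [yx|xy] := ltP `|y - x1| rho.
  have := lt_le_trans (h _ yx) fy; rewrite lte_fin => /ltW/(le_trans _); apply.
  by rewrite lerBlDr lerDl mulr_ge0// divr_ge0// ltW.
have yx0 : 0 < `|y - x1| by apply: lt_le_trans xy.
pose t := rho / 2 / `|y - x1|.
have t0 : 0 < t by rewrite !divr_gt0.
have t1 : t < 1 by rewrite ltr_pdivrMr//; lra.
have fxa : (f x1 <= a%:E)%E by rewrite fa.
have := econvex_le fconv t0 t1 fy fxa; rewrite leNgt => hh.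
suff : (a - 1) < t * s + (1 - t) * a.
  have e1 : 2 / rho * `|y - x1| = t^-1 by rewrite /t; field; rewrite !gt_eqF.
  rewrite e1 => h1; have : - 1 < t * (s - a) by lra.
  by rewrite mulrC -ltr_pdivrMr// mulN1r; lra.
rewrite ltNge; apply/negP => h1; move/negP: hh; apply.
apply: le_lt_trans (h _ _); first by rewrite lee_fin.
have -> : t *: y + (1 - t) *: x1 - x1 = t *: (y - x1).
  by rewrite scalerBl scale1r scalerBr addrAC addrA subrK.
by rewrite normrZ gtr0_norm// divfK ?gt_eqF//; lra.
Qed.

(** Steepening the cone of the previous lemma to cover the region where
semicontinuity at [x] gives no information. *)
Lemma lsc_convex_cone_minorant x (r : R) : (r%:E < f x)%E ->
  exists n, 0 <= n /\ forall y s, (f y <= s%:E)%E -> r - n * `|y - x| <= s.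
Proof.
move=> /lsc_ball[rho rho0 h].
have [x1 [c [n [n0 hn]]]] := lsc_convex_lower_bound.
pose m := `|r - c + n * `|x - x1| | / rho.
have m0 : 0 <= m by rewrite divr_ge0// ltW.
exists (n + m); split; first by rewrite addr_ge0.
move=> y s fy; have [yx|xy] := ltP `|y - x| rho.
  have := lt_le_trans (h _ yx) fy; rewrite lte_fin => /ltW/(le_trans _); apply.
  by rewrite lerBlDr lerDl mulr_ge0// addr_ge0.
have := hn _ _ fy.
have : n * `|y - x1| <= n * `|y - x| + n * `|x - x1|.
  by rewrite -mulrDr ler_wpM2l// ler_distD.
have : r - c + n * `|x - x1| <= m * `|y - x|.
  apply: (le_trans (ler_norm _)).
  by rewrite -mulrA ler_peMr// ler_pdivlMl// mulr1.
by lra.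
Qed.

(** Sandwich an affine function between [f] and the concave cone with apex
[(x, r)]. *)
Lemma affine_minorant x (r : R) : (r%:E < f x)%E ->
  exists phi : dual Z, forall y, ((r + phi (y - x))%R%:E <= f y)%E.
Proof.
move=> /lsc_convex_cone_minorant[n [n0 hn]].
have [||phi [_ phiP]] := sandwich n0 (@epigraph_convexset _ _ _ fconv x r) (@linrel0 R Z).
- by move=> _ _ [-> ->]; rewrite normr0 mulr0.
- move=> _ _ w s t [-> ->] /= fw t0.
  rewrite sub0r normrN normrZ gtr0_norm// mulrCA -mulrDr; apply: mulr_ge0; first exact: ltW.
  by have := hn _ _ fw; rewrite [x + w]addrC addrK; lra.
exists phi => y; apply: ge_epigraph => s fy.
by have := phiP (y - x) (s - r); rewrite /= !subrKC => /(_ fy); lra.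
Qed.

End LowerSemicontinuous.

(** * Bounds near interior points and one-dimensional minimisation *)

(** By Baire's theorem some set [f > n] is not dense, so [f <= n] on some ball,
with centre [y0] say.  Any [x0] interior to the domain is a convex
combination of [y0] and of a point [y1] of the domain slightly beyond [x0]. *)
Lemma convex_bounded_near (R : realType) (X : completeNormedModType R)
    (f : X -> \bar R) x0 (delta0 : R) :
  lower_semicontinuous f -> econvex f -> 0 < delta0 ->
  (forall h, `|h| < delta0 -> f (x0 + h) != +oo%E) ->
  exists delta M : R, 0 < delta /\
    forall h, `|h| <= delta -> (f (x0 + h)%R <= M%:E)%E.
Proof.
move=> flsc fconv d0 fdom.
pose O (n : nat) := [set x | (n%:R%:E < f x)%E].
have Oopen n : open (O n) by move/lower_semicontinuousP: flsc; exact.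
have [y0 [rho [N [rho0 fN]]]] : exists y0 (rho : R) (N : nat), 0 < rho /\
    forall y, `|y - y0| < rho -> (f y <= N%:R%:E)%E.
  apply: contrapT => hno.
  have Odense n : dense (O n).
    move=> U [y Uy] Uopen; apply: contrapT => UO.
    have /nbhs_ballP[rho /= rho0 rhoU] : nbhs y U by exact: open_nbhs_nbhs.
    apply: hno; exists y, rho, n; split=> // z zy.
    rewrite leNgt; apply/negP => fz; apply: UO; exists z; split => //.
    by apply: rhoU; rewrite -ball_normE /= distrC.
  have := @Baire R X O (fun n => conj (Oopen n) (Odense n)).
  move=> /(_ (ball x0 delta0)) [||z [zx zO]].
  - by exists x0; exact: ballxx.
  - exact: ball_open.
  - have /= := fdom (z - x0); rewrite subrKC.
    move: zx; rewrite -ball_normE /= distrC => zx /(_ zx) fz.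
    have : (0%:E < f z)%E by exact: (zO 0%N).
    case fzE : (f z) fz => [r| |] // _ r0.
    have : ((Num.bound r)%:R%:E < r%:E)%E by rewrite -fzE; exact: (zO (Num.bound r)).
    rewrite lte_fin ltNge => /negP; apply.
    by rewrite ltW// archi_boundP// ltW// -lte_fin.
(* Small enough for [y1], beyond [x0] on the ray from [y0], to be in the domain. *)
pose tau := delta0 / 2 / (`|x0 - y0| + 1).
have k0 : 0 < `|x0 - y0| + 1 by rewrite ltr_wpDl.
have tau0 : 0 < tau by rewrite !divr_gt0.
pose y1 := x0 + tau *: (x0 - y0).
have fy1 : f y1 != +oo%E.
  apply: fdom; rewrite normrZ gtr0_norm// /tau mulrAC ltr_pdivrMr//.
  have : 0 <= delta0 / 2 by rewrite divr_ge0 ?ltW.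
  have := normr_ge0 (x0 - y0); nra.
have [s fs] : exists s : R, (f y1 <= s%:E)%E.
  by case: (f y1) fy1 => [s _|//|_]; [exists s|exists 0; rewrite leNye].
pose l := (1 + tau)^-1.
have t1 : 0 < 1 + tau by lra.
have l0 : 0 < l by rewrite invr_gt0.
have l1 : l < 1 by rewrite invf_lt1//; lra.
exists (rho * (1 - l) / 2), (l * s + (1 - l) * N%:R); split.
  by rewrite divr_gt0// mulr_gt0//; lra.
move=> h hh.
have := econvex_le fconv l0 l1 fs (fN (y0 + (1 - l)^-1 *: h) _).
have -> : l *: y1 + (1 - l) *: (y0 + (1 - l)^-1 *: h) = x0 + h.
  have l1n : 1 - l != 0 by rewrite gt_eqF//; lra.
  rewrite [(1 - l) *: _]scalerDr scalerA mulfV// scale1r addrA; congr (_ + _).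
  have -> : y1 = (1 + tau) *: x0 - tau *: y0.
    by rewrite /y1 scalerBr scalerDl scale1r addrA.
  have -> : 1 - l = l * tau by rewrite /l; field; rewrite gt_eqF.
  by rewrite scalerBr !scalerA /l mulVf ?gt_eqF// scale1r subrK.
apply; rewrite addrC addKr normrZ gtr0_norm ?invr_gt0; last by lra.
rewrite mulrC ltr_pdivrMr; last by lra.
apply: (le_lt_trans hh); rewrite ltr_pdivrMr// ltr_pMr ?ltr1n// mulr_gt0//; lra.
Qed.

(** A minimising sequence is bounded, because the quadratic penalty beats
the linear lower bound; a cluster point is a minimiser by semicontinuity. *)
Lemma penalised_min (R : realType) (q : R -> \bar R) (K c0 : R) :
  0 <= K -> lower_semicontinuous q ->
  (forall s r, (q s <= r%:E)%E -> - (K * (1 + `|s|)) <= r) ->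
  (q 0%R <= c0%:E)%E ->
  exists s r : R, q s = r%:E /\
    forall s' r', (q s' <= r'%:E)%E -> r + (s - 1) ^+ 2 / 2 <= r' + (s' - 1) ^+ 2 / 2.
Proof.
move=> K0 qlsc qK q0.
pose L := [set x | exists s r, (q s <= r%:E)%E /\ x = r + (s - 1) ^+ 2 / 2].
have Llb : has_inf L.
  split; first by exists (c0 + (0 - 1) ^+ 2 / 2), 0, c0.
  exists (- (K * (K + 2)) - K) => _ [s [r [/qK qs ->]]].
  suff : - (K * (K + 2)) - K <= - (K * (1 + `|s|)) + (s - 1) ^+ 2 / 2 by lra.
  have := ler_norm s; have := ler_norm (- s); rewrite normrN => h1 h2.
  have : (`|s| - 1) ^+ 2 <= (s - 1) ^+ 2.
    by have := real_normK (num_real s); nra.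
  have := sqr_ge0 (`|s| - 1 - K); nra.
pose mu := inf L.
have muP s r : (q s <= r%:E)%E -> mu <= r + (s - 1) ^+ 2 / 2.
  by move=> qs; apply: inf_lbound; [exact: Llb.2|exists s, r].
have /choice[u uP] (n : nat) : exists s, exists r, (q s <= r%:E)%E /\
    r + (s - 1) ^+ 2 / 2 < mu + n.+1%:R^-1.
  have [_ [s [r [qs ->]]] h] := @inf_adherent _ L n.+1%:R^-1 ltac:(by rewrite invr_gt0) Llb.
  by exists s, r.
(* Beyond [B] the penalty exceeds [K * (1 + `|s|) + mu + 1]. *)
pose B := 2 * K + 3 + `|mu + 1|.
have uB n : u n \in `[- B, B].
  rewrite in_itv /= -ler_norml.
  have [r [/qK qr h]] := uP n.
  have n1 : n.+1%:R^-1 <= 1 :> R by rewrite invf_le1// ler1n.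
  have h2 : - (K * (1 + `|u n|)) + (u n - 1) ^+ 2 / 2 <= `|mu + 1|.
    have := ler_norm (mu + 1); move: h n1; move: (n.+1%:R^-1 : R) => a; lra.
  rewrite /B leNgt; apply/negP => h3.
  have : (`|u n| - 1) ^+ 2 <= (u n - 1) ^+ 2.
    by have := ler_norm (u n); have := real_normK (num_real (u n)); nra.
  have := normr_ge0 (mu + 1); move: h2 h3; move: `|mu + 1| `|u n| => m v.
  nra.
have [s [_ scl]] : [set` `[- B, B]] `&` cluster (u @ \oo) !=set0.
  apply: (@segment_compact R (- B) B (u @ \oo)).
  by exists 0%N => // n _ /=; exact: uB.
have qs : (q s <= (mu - (s - 1) ^+ 2 / 2)%R%:E)%E.
  rewrite leNgt; apply/negP => /ereal_between[a ha /qlsc[V sV Va]].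
  pose d := (a + (s - 1) ^+ 2 / 2 - mu) / 2.
  have d0 : 0 < d by rewrite /d; lra.
  have c : {for s, continuous (fun v : R => (v - 1) ^+ 2 / 2)}.
    apply: continuousM; last exact: cst_continuous.
    apply: continuousM; apply: continuousB => //; exact: cst_continuous.
  have /cvgrPdist_lt/(_ _ d0) W := c.
  have [N _ hN] : \forall n \near \oo, n.+1%:R^-1 < d.
    by near=> n; near: n; exact: near_infty_natSinv_lt (PosNum d0).
  have tail : (u @ \oo) (u @` [set n | (N <= n)%N]).
    by exists N => // n Nn; exists n.
  have [_ [[n Nn <-] [Vn Wn]]] := scl _ _ tail (filterI sV W).
  have [r [qr hr]] := uP n.
  have := lt_le_trans (Va _ Vn) qr; rewrite lte_fin => ar.
  have := hN _ Nn; move: Wn hr; rewrite /= => /ltr_distlBl.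
  move: (n.+1%:R^-1 : R) => b; rewrite /d; lra.
have qsN : q s \is a fin_num.
  rewrite fin_numE; apply/andP; split; apply/eqP => E; last by rewrite E in qs.
  by have := qK s (- (K * (1 + `|s|)) - 1); rewrite E leNye lerBrDr gerDl ler10 => /(_ isT).
exists s, (fine (q s)); split; first by rewrite fineK.
move=> s' r' /muP; move: qs; rewrite -{1}(fineK qsN) lee_fin; lra.
Unshelve. all: by end_near. Qed.

(** A proximal step along the line through [x0] with direction [d].  Unlike the
subgradients of [f] at prescribed points of the line, which need not exist,
the minimiser of the penalised function always carries one, and the
optimality condition prescribes its value on [d]. *)
Lemma prox_line (R : realType) (Z : normedModType R) (f : Z -> \bar R)
    (x0 d : Z) (delta M : R) :
  eproper f -> lower_semicontinuous f -> econvex f -> 0 < delta ->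
  (forall h, `|h| <= delta -> (f (x0 + h)%R <= M%:E)%E) ->
  exists s phi, subdifferential f (x0 + s *: d) phi /\ phi d = 1 - s.
Proof.
move=> fproper flsc fconv d0 fM.
have [x1 [c [n [n0 hn]]]] := lsc_convex_lower_bound fproper flsc fconv.
pose q (s : R) := f (x0 + s *: d).
pose K := `|c| + n * `|x0 - x1| + n * `|d|.
have nd : 0 <= n * `|d| by rewrite mulr_ge0.
have nx : 0 <= n * `|x0 - x1| by rewrite mulr_ge0.
have K0 : 0 <= K by rewrite !addr_ge0.
have qlsc : lower_semicontinuous q.
  move=> s a /flsc[V sV Va].
  have c1 : {for s, continuous (fun t : R => x0 + t *: d)}.
    by apply: continuousD; [exact: cst_continuous|exact: continuousZr_tmp].
  by exists ((fun t : R => x0 + t *: d) @^-1` V); [exact: c1|move=> t /Va].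
have qK s r : (q s <= r%:E)%E -> - (K * (1 + `|s|)) <= r.
  move=> /hn; rewrite addrAC => h.
  have : n * `|x0 - x1 + s *: d| <= n * `|x0 - x1| + `|s| * (n * `|d|).
    by rewrite mulrCA -mulrDr ler_wpM2l// -normrZ ler_normD.
  have h1 := ler_norm (- c); rewrite normrN in h1.
  have h2 : 0 <= `|s| * (`|c| + n * `|x0 - x1|) by rewrite mulr_ge0// addr_ge0.
  by rewrite /K; lra.
have q0 : (q 0%R <= M%:E)%E by rewrite /q scale0r; apply: fM; rewrite normr0 ltW.
have [s [r [qs smin]]] := penalised_min K0 qlsc qK q0.
(* First-order optimality: compare with [s + t * (a - s)] for small [t]. *)
have slope a v : (q a <= v%:E)%E -> r + (a - s) * (1 - s) <= v.
  move=> qa; apply/ler_addgt0Pl => eps eps0.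
  pose t := Num.min (1 / 2) (eps / ((a - s) ^+ 2 + 1)).
  have k0 : 0 < (a - s) ^+ 2 + 1 by rewrite ltr_wpDl// sqr_ge0.
  have t0 : 0 < t by rewrite /t lt_min divr_gt0// divr_gt0.
  have t1 : t < 1 by rewrite /t gt_min; apply/orP; left; lra.
  have te : t * ((a - s) ^+ 2 + 1) <= eps.
    by rewrite -ler_pdivlMr// /t ge_min lexx orbT.
  have qsr : (q s <= r%:E)%E by rewrite qs.
  have := econvex_le fconv t0 t1 qa qsr.
  have -> : t *: (x0 + a *: d) + (1 - t) *: (x0 + s *: d) =
            x0 + (t * a + (1 - t) * s) *: d.
    by rewrite !scalerDr addrACA -scalerDl subrKC scale1r !scalerA -scalerDl.
  move=> /smin h.
  have {}h : 0 <= t * (v - r - (a - s) * (1 - s) + t * (a - s) ^+ 2 / 2) by lra.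
  rewrite pmulr_rge0// in h.
  have := mulr_ge0 (ltW t0) (sqr_ge0 (a - s)); lra.
have Gl : linrel [set p : Z * R^o | exists a, p = (a *: d, a * (1 - s))].
  split; first by exists 0; rewrite scale0r mul0r.
  move=> a _ _ _ _ [b [-> ->]] [b' [-> ->]]; exists (a * b + b').
  by rewrite scalerDl scalerA mulrDl mulrA.
have [|phi [phid phiP]] := convex_extension fconv (c := r - s * (1 - s)) d0 fM Gl.
  by move=> _ _ v [a [-> ->]] /slope; lra.
have phi_d : phi d = 1 - s by apply: phid; exists 1; rewrite scale1r mul1r.
exists s, phi; split => // y; rewrite -/(q s) qs -EFinD.
have := phiP (y - x0); rewrite subrKC; congr (_ <= _)%E; congr EFin.
by rewrite !dualB dualD dualZ phi_d; ring.
Qed.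

(** * Fenchel conjugates and subdifferentials *)

Section Fenchel.
Variables (R : realType) (Z : normedModType R) (f : Z -> \bar R).
Hypothesis (fproper : eproper f).

Lemma fenchel_young_le (x : Z) (xs : dual Z) (a b : R) :
  (f x <= a%:E)%E -> (fenchel_conj f xs <= b%:E)%E -> xs x <= a + b.
Proof.
move=> fa fb; rewrite -lerBlDl -lee_fin.
apply: le_trans fb; rewrite EFinB.
apply: (@le_trans _ _ ((xs x)%:E - f x)%E); first exact: leeB.
by apply: ereal_sup_ubound; exists x.
Qed.

(** The supremum only needs to be tested on the epigraph. *)
Lemma fenchel_conj_le (xs : dual Z) (b : R) :
  (forall x a, (f x <= a%:E)%E -> xs x - a <= b) -> (fenchel_conj f xs <= b%:E)%E.
Proof.
move=> h; apply: ge_ereal_sup => _ [x _ <-].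
have [fN _] := fproper; have := fN x; have := h x.
case: (f x) => [a|_|] // => [/(_ a (lexx _))|].
  by rewrite -EFinB lee_fin.
by rewrite leNye.
Qed.

Lemma fenchel_conj_Nninfty (xs : dual Z) : fenchel_conj f xs != -oo%E.
Proof.
have [_ [x fx]] := fproper.
rewrite gt_eqF// (@lt_le_trans _ _ ((xs x)%:E - f x)%E)//.
  by rewrite -(fineK fx) -EFinB ltNyr.
by apply: ereal_sup_ubound; exists x.
Qed.

Hypotheses (flsc : lower_semicontinuous f) (fconv : econvex f).

Lemma fenchel_conj_proper : eproper (fenchel_conj f).
Proof.
split; first exact: fenchel_conj_Nninfty.
have [fN [x fx]] := fproper.
have [|phi phiP] := affine_minorant fproper flsc fconv (x := x) (r := fine (f x) - 1).
  by rewrite -{2}(fineK fx) lte_fin; lra.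
exists phi; rewrite /efdom/= fin_numE fenchel_conj_Nninfty/=.
rewrite lt_eqF// (@le_lt_trans _ _ (phi x - (fine (f x) - 1))%:E) ?ltry//.
apply: fenchel_conj_le => y a fy.
have := le_trans (phiP y) fy; rewrite lee_fin dualB; lra.
Qed.

Lemma fenchel_moreau (x : Z) :
  (f x <= fenchel_conj (fenchel_conj f) (bidual_emb x))%E.
Proof.
set k := fenchel_conj (fenchel_conj f) (bidual_emb x).
have kub xs : (((bidual_emb x) xs)%:E - fenchel_conj f xs <= k)%E.
  by apply: ereal_sup_ubound; exists xs.
have [_ [xs0 fxs0]] := fenchel_conj_proper.
have := kub xs0; rewrite -(fineK fxs0) -EFinB.
case: k kub => [b|_ _|_]; [move=> kub _|by rewrite leey|by rewrite leeNy_eq].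
rewrite leNgt; apply/negP => /ereal_between[r br rf].
have [phi phiP] := affine_minorant fproper flsc fconv rf.
have : (fenchel_conj f phi <= (phi x - r)%:E)%E.
  apply: fenchel_conj_le => y a fy.
  have := le_trans (phiP y) fy; rewrite lee_fin dualB; lra.
have := kub phi; have := fenchel_conj_Nninfty phi.
case: (fenchel_conj f phi) => [t| |]// _; rewrite -EFinB !lee_fin /=; lra.
Qed.

End Fenchel.

Section Subdifferential.
Variables (R : realType) (Z : normedModType R) (f : Z -> \bar R).
Hypothesis fproper : eproper f.
Notation fs := (fenchel_conj f).

Lemma subdifferential_fin z b : subdifferential f z b -> f z \is a fin_num.
Proof.
have [fN [x1 fx1]] := fproper => /(_ x1); have := fN z.
case: (f z) => [//| |]// _; rewrite addey// leye_eq => /eqP h.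
by move: fx1; rewrite /efdom /= h.
Qed.

Lemma fenchel_conj_subdifferential z b : subdifferential f z b ->
  (fs b <= (b z - fine (f z))%:E)%E.
Proof.
move=> zb; apply: fenchel_conj_le => // x a fx.
have := le_trans (zb x) fx; rewrite -(fineK (subdifferential_fin zb)) -EFinD lee_fin.
by rewrite dualB /=; lra.
Qed.

Lemma subdifferential_monotone x b x' b' : subdifferential f x b ->
  subdifferential f x' b' -> 0 <= (b - b') (x - x').
Proof.
move=> xb xb'; have fx := fineK (subdifferential_fin xb).
have fx' := fineK (subdifferential_fin xb').
have := xb x'; have := xb' x; rewrite -fx -fx' -!EFinD !lee_fin dualBE !dualB; lra.
Qed.

End Subdifferential.

Section Tilt.
Variables (R : realType) (Z : normedModType R) (f : Z -> \bar R) (phi : dual Z).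

Definition tilt : Z -> \bar R := fun x => (f x - (phi x)%:E)%E.

Lemma tilt_le x (r : R) : (tilt x <= r%:E)%E = (f x <= (r + phi x)%:E)%E.
Proof. by rewrite /tilt leeBlDr// -EFinD. Qed.

Lemma tilt_gt x (r : R) : (r%:E < tilt x)%E = ((r + phi x)%:E < f x)%E.
Proof. by rewrite /tilt lteBrDr// -EFinD. Qed.

Lemma tilt_proper : eproper f -> eproper tilt.
Proof.
move=> [fN [x fx]]; split; last by exists x; rewrite /efdom /= /tilt fin_numB fx.
by move=> y; rewrite /tilt; have := fN y; case: (f y).
Qed.

Lemma tilt_lsc : lower_semicontinuous f -> lower_semicontinuous tilt.
Proof.
move=> flsc x a; rewrite tilt_gt => /ereal_between[c ac /flsc[V xV cV]].
have d0 : 0 < c - (a + phi x) by lra.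
have /cvgrPdist_lt/(_ _ d0) W := @dual_continuous _ _ phi x.
exists (V `&` [set y | `|phi x - phi y| < c - (a + phi x)]).
  exact: filterI.
move=> y [/cV cy /= xy]; rewrite tilt_gt; apply: le_lt_trans cy.
by rewrite lee_fin; have := ler_norm (phi y - phi x); rewrite distrC; lra.
Qed.

Lemma tilt_convex : eproper f -> econvex f -> econvex tilt.
Proof.
move=> fproper fconv; apply: econvex_of_le; first by case: (tilt_proper fproper).
move=> x y r s t t0 t1 xr ys.
have fx : (f x <= (r + phi x)%:E)%E by rewrite -tilt_le xr.
have fy : (f y <= (s + phi y)%:E)%E by rewrite -tilt_le ys.
have := econvex_le fconv t0 t1 fx fy; rewrite tilt_le => /le_trans; apply.
by rewrite lee_fin dualD !dualZ; lra.
Qed.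

(** Tilting by [phi] shifts subgradients by [phi]. *)
Lemma tilt_subdifferential x b :
  subdifferential tilt x b -> subdifferential f x (b + phi).
Proof.
move=> h y; have := h y; rewrite /tilt.
rewrite -[dual_fun (b + phi) _]/(b (y - x) + phi (y - x)).
case: (f x) => [r| |]; case: (f y) => [s| |]; rewrite ?leey ?addeNy ?leNye//=.
by rewrite -!EFinD !lee_fin !dualB; lra.
Qed.

End Tilt.

Section SeparableSum.
Variables (R : realType) (X : normedModType R) (f : X -> \bar R).
Hypotheses (fproper : eproper f) (flsc : lower_semicontinuous f) (fconv : econvex f).
Notation fs := (fenchel_conj f).

Lemma fenchel_conj_convex : econvex fs.
Proof.
apply: econvex_of_le; first exact: fenchel_conj_Nninfty.
move=> x y r s t t0 t1 xr ys; apply: fenchel_conj_le => // z a fz.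
have h1 : x z <= a + r by apply: (fenchel_young_le fz); rewrite xr.
have h2 : y z <= a + s by apply: (fenchel_young_le fz); rewrite ys.
rewrite dualDE !dualZE.
have := ler_wpM2l (ltW t0) h1; have t1' : 0 <= 1 - t by lra.
have := ler_wpM2l t1' h2; lra.
Qed.

(** For the conjugate inequality take [r1 < f x] and [r2 < f^* y]: an affine
minorant [phi] of [f] with value [r1] at [x], and a point [z] nearly attaining [f^* y],
form a point [(z, phi)] that witnesses the bound [r1 + r2]. *)
Lemma separable_BC : BC_function (fun p : X * dual X => (f p.1 + fs p.2)%E).
Proof.
have [fN [x1 fx1]] := fproper.
have [fsN [y1 fsy1]] := fenchel_conj_proper fproper flsc fconv.
split.
- split=> [[x y]|]; first by rewrite /= adde_eq_ninfty negb_or fN fsN.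
  by exists (x1, y1); rewrite /efdom /= fin_numD fx1.
- apply: econvex_of_le => [[x y]|[x y] [x' y'] r s t t0 t1] /=.
    by rewrite adde_eq_ninfty negb_or fN fsN.
  have := @fenchel_conj_convex y y' t t0 t1; have := fconv x x' t0 t1.
  have := fN x; have := fN x'; have := fsN y; have := fsN y'.
  case: (f x) => [a| |]//; case: (f x') => [a'| |]//;
    case: (fs y) => [b| |]//; case: (fs y') => [b'| |]// _ _ _ _ h1 h2 [<-] [<-].
  apply: (le_trans (leeD h1 h2)); rewrite -!EFinM -!EFinD lee_fin; lra.
- move=> x y; split; last first.
    apply: le_lt_ereal => r; rewrite lte_fin /= => /ltW ry.
    have := fN x; have := fsN y; have := @fenchel_young_le _ _ f x y.
    case: (f x) => [a| |]//; case: (fs y) => [b| |]// h _ _; rewrite ?leey//.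
    by rewrite lee_fin (le_trans ry)//; apply: h.
  apply: le_lt_ereal => r /= /lt_adde_split[//|//|r1 [r2 [-> xr1 yr2]]].
  have [phi phiP] := affine_minorant fproper flsc fconv xr1.
  have fsphi : (fs phi <= (phi x - r1)%:E)%E.
    apply: fenchel_conj_le => // z a fz.
    by have := le_trans (phiP z) fz; rewrite lee_fin dualB; lra.
  have [z yz] : exists z, (r2%:E < (y z)%:E - f z)%E.
    by have /ereal_sup_gt[_ [z _ <-]] := yr2; exists z.
  apply: (@le_trans _ _ ((y z + phi x)%:E - (f z + fs phi))%E); last first.
    by apply: ereal_sup_ubound; exists (z, phi).
  move: yz fsphi; have := fN z; have := fsN phi.
  case: (f z) => [a| |]//; case: (fs phi) => [b| |]// _ _.
  rewrite -EFinD -!EFinB lte_fin !lee_fin; lra.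
Qed.

End SeparableSum.

(** * Maximal monotonicity and points of the bidual *)

Section MonotoneOperators.
Variable R : realType.

Lemma maximally_monotone_related (U V : zmodType) (pairing : U -> V -> R)
    (G : set (U * V)) : monotone_for pairing G ->
  (forall p, (forall q, G q -> 0 <= pairing (p.1 - q.1) (p.2 - q.2)) -> G p) ->
  maximally_monotone_for pairing G.
Proof.
move=> Gm GP; split=> // H Hm GH; apply/seteqP; split=> // p Hp.
by apply: GP => q /GH; exact: Hm.
Qed.

(** As for Hahn-Banach, [M] stands for [M `|` G], so that the empty chain is
admissible. *)
Lemma maximal_extension (U V : zmodType) (pairing : U -> V -> R)
    (G : set (U * V)) : monotone_for pairing G ->
  exists2 H, maximally_monotone_for pairing H & G `<=` H.
Proof.
move=> Gm; have [M [Mm Mmax]] : exists M, monotone_for pairing (M `|` G) /\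
    forall B, M `<` B -> ~ monotone_for pairing (B `|` G).
  apply: Zorn_bigcup => F Fm Ftot p q [[S1 F1 Sp]|Gp] [[S2 F2 Sq]|Gq].
  - have [S12|S21] := Ftot _ _ F1 F2.
    + by apply: (Fm _ F2); left => //; exact: S12.
    + by apply: (Fm _ F1); left => //; exact: S21.
  - by apply: (Fm _ F1); [left|right].
  - by apply: (Fm _ F2); [right|left].
  - exact: Gm.
exists (M `|` G) => //; split=> // H Hm MH; apply/seteqP; split=> // p Hp.
left; apply: contrapT => nMp; apply: (Mmax H).
  by split=> [q Mq|HM]; [apply: MH; left|exact/nMp/HM].
by rewrite setUidl// => q Gq; apply: MH; right.
Qed.

Variable Z : normedModType R.
Implicit Type B : Z -> set (dual Z).

(** With [c = 0] this says that [q] is monotonically related to the graph in the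
bidual; a positive [c] is the quantitative form that excludes type (D). *)
Definition bidual_gap B (c : R) (q : dual (dual Z) * dual Z) : Prop :=
  forall x xs, B x xs -> c <= (bidual_emb x - q.1) (xs - q.2).

(** Along the net of the definition the first components stay bounded and the
second ones converge in norm, so the pairings with [q] would tend to 0. *)
Lemma not_type_D B c q : 0 < c -> bidual_gap B c q -> ~ type_D B.
Proof.
case: q => xss xs c0 gap /(_ xss xs) [|I [le [a [[[i0] le_refl _ _] agra abnd _ acvg]]]].
  apply: le_ereal_inf_tmp => _ [[x xs'] Bx <-]; rewrite lee_fin.
  by apply: le_trans (gap _ _ Bx); exact: ltW.
have [K [Kr hK]] := abnd.
have {}hK i : `|a i| <= `|K| + 1.
  by apply: (hK (`|K| + 1)); [rewrite ltr_pwDr// ler_norm|exists i].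
pose k : R := `|K| + 1 + `|xss|.
have k0 : 0 < k by rewrite /k; have := normr_ge0 K; have := normr_ge0 xss; lra.
have ck0 : 0 < c / k by rewrite divr_gt0.
have : nbhs xs (ball xs (c / k)) by exact: nbhsx_ballx.
move=> /acvg[i hi]; have := hi i (le_refl i); rewrite -ball_normE /= => xa.
have aiB : range a (a i) by exists i.
have := gap _ _ (agra _ aiB).
apply/negP; rewrite -ltNge; apply: le_lt_trans (ler_norm _) _.
apply: le_lt_trans (dual_normP _ _) _.
rewrite /= (distrC (a i).2).
apply: (@le_lt_trans _ _ (k * `|xs - (a i).2|)).
  rewrite ler_wpM2r//; apply: (le_trans (ler_normB _ _)); rewrite emb_norm /k.
  have : `|(a i).1| <= `|a i| by rewrite prod_normE le_max lexx.
  have := hK i; lra.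
by rewrite mulrC -ltr_pdivlMr.
Qed.

(** Each of [p] and [q] belongs to some maximal extension; a common one would
contain both. *)
Lemma not_unique_bidual B p q :
  (forall x xs y ys, B x xs -> B y ys -> 0 <= (xs - ys) (x - y)) ->
  bidual_gap B 0 p -> bidual_gap B 0 q -> (p.1 - q.1) (p.2 - q.2) < 0 ->
  ~ unique_bidual B.
Proof.
move=> Bm Bp Bq pq uniq.
pose pairing (zss : dual (dual Z)) (zs : dual Z) : R := zss zs.
pose G := [set (bidual_emb p.1, p.2) | p in gra B].
have flip (u v : dual (dual Z)) (a b : dual Z) :
    dual_fun (u - v) (a - b) = dual_fun (v - u) (b - a).
  by rewrite !dualBE !dualB; ring.
have ext r : bidual_gap B 0 r ->
    exists H, [/\ maximally_monotone_for pairing H, G `<=` H & H r].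
  move=> Br; have [|H Hm GH] := @maximal_extension _ _ pairing (G `|` [set r]).
    move=> _ _ [[[x xs] Bx <-]|->] [[[y ys] By <-]|->]; rewrite /pairing /=.
    - by have := Bm _ _ _ _ Bx By; rewrite dualB.
    - exact: Br.
    - by have := Br _ _ By; rewrite flip.
    - by rewrite !subrr.
  by exists H; split => // [s Gs|]; apply: GH; [left|right].
have [H1 [m1 G1 h1]] := ext _ Bp.
have [H2 [m2 G2 h2]] := ext _ Bq.
have E := uniq _ _ m1 G1 m2 G2.
have := m1.1 p q h1; rewrite E => /(_ h2); rewrite /pairing leNgt pq.
by [].
Qed.

End MonotoneOperators.

(** * The operator A *)

Section OutsideX.
Variables (R : realType) (X : completeNormedModType R).

(** Otherwise [e] would be in the closure of [X], hence in [X]. *)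
Lemma functional_vanishing_on_X (e : dual (dual X)) :
  ~ range (@bidual_emb R X) e ->
  exists w : dual (dual (dual X)), (forall x, w (bidual_emb x) = 0) /\ w e = 1.
Proof.
move=> eX; apply: contrapT => now; apply: eX; apply: emb_range_closed.
apply: annihilator_approx; first by exists 0 => //; rewrite linear0.
  by move=> a _ _ [x _ <-] [y _ <-]; exists (a *: x + y) => //; rewrite linearP.
move=> phi phi0; apply/eqP; apply: contrapT => /negP pe; apply: now.
exists ((phi e)^-1 *: phi); split=> [x|]; rewrite dualZE; last by rewrite mulVf.
by rewrite (phi0 (bidual_emb x)) ?mulr0//; exists x.
Qed.

Lemma bidual_outside_scale (e : dual (dual X)) x r :
  ~ range (@bidual_emb R X) e -> bidual_emb x = r *: e -> r = 0 /\ x = 0.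
Proof.
move=> eX xe; have r0 : r = 0.
  apply/eqP; apply: contrapT => /negP r0; apply: eX; exists (r^-1 *: x) => //.
  by rewrite linearZ/= xe scalerA mulVf// scale1r.
by split=> //; apply: emb_inj; rewrite xe r0 scale0r linear0.
Qed.

Lemma bidual_outside_unit (e : dual (dual X)) :
  ~ range (@bidual_emb R X) e -> exists u, e u = 1.
Proof.
move=> eX; have [[u eu]|h] := pselect (exists u, e u != 0).
  by exists ((e u)^-1 *: u); rewrite dualZ mulVf.
exfalso; apply: eX; exists 0 => //; rewrite linear0; apply: dualP => u.
by apply/esym/eqP; apply: contrapT => /negP eu; apply: h; exists u.
Qed.

End OutsideX.

Section QuadraticOperator.
Variables (R : realType) (X : completeNormedModType R).
Variables (A : {linear dual X -> dual (dual X)}) (cA : continuous A).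
Variables (e : dual (dual X)).
Hypothesis eX : ~ range (@bidual_emb R X) e.
Hypothesis Ae : forall x : dual X, A x x = e x ^+ 2.
Implicit Types x y u v : dual X.

Lemma op_comb x y (a : R) v : A (x + a *: y) v = A x v + a * A y v.
Proof. by rewrite linearD linearZ. Qed.

Lemma op_scale x (a : R) v : A (a *: x) v = a * A x v.
Proof. by rewrite linearZ. Qed.

Lemma op_sub x y v : A (x - y) v = A x v - A y v.
Proof. by rewrite linearB. Qed.

(** Polarisation of the quadratic identity at [x + y]. *)
Lemma quadratic_polar x y : A x y + A y x = 2 * e x * e y.
Proof.
have := Ae (x + 1 *: y); rewrite op_comb !scale1r mul1r !dualD !Ae => h.
have -> : A x y + A y x = (e x + e y) ^+ 2 - e x ^+ 2 - e y ^+ 2.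
  by rewrite -h; ring.
by ring.
Qed.

Lemma lin_adjointE x : lin_adjoint cA x = (2 * e x) *: e - A x.
Proof.
apply: dualP => y; rewrite dualBE dualZE /=.
by have := quadratic_polar x y; lra.
Qed.

Lemma symmetric_partE x : symmetric_part cA x = e x *: e.
Proof.
rewrite /symmetric_part lin_adjointE subrKC scalerA; congr (_ *: _).
by rewrite mulrA mulVf// mul1r.
Qed.

Lemma skew_partE x : skew_part cA x = A x - e x *: e.
Proof.
apply: dualP => y; rewrite /skew_part lin_adjointE.
by rewrite dualZE !dualBE !dualZE; lra.
Qed.

Lemma op_monotone x y : 0 <= (A x - A y) (x - y).
Proof. by rewrite dualBE -op_sub Ae sqr_ge0. Qed.

(** Minty's argument: test a related point against [z - t *: w] and let [t] tend
to 0. *)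
Lemma quadratic_maximally_monotone : maximally_monotone (op_fun A).
Proof.
apply: maximally_monotone_related.
  move=> [x xs] [y ys]; rewrite /gra /op_fun /= => -> ->.
  exact: op_monotone.
move=> [z zs] h; rewrite /gra /op_fun /=; apply: dualP => y.
suff H w : 0 <= zs w - A z w.
  have := H y; have := H (- y); rewrite !dualN; lra.
apply/ler_addgt0Pr => eps eps0.
pose t := eps / (e w ^+ 2 + 1).
have k0 : 0 < e w ^+ 2 + 1 by rewrite ltr_wpDl// sqr_ge0.
have t0 : 0 < t by rewrite divr_gt0.
have : 0 <= (zs - A (z + (- t) *: w)) (z - (z + (- t) *: w)).
  exact: (h (z + (- t) *: w, A (z + (- t) *: w)) erefl).
have -> : z - (z + (- t) *: w) = t *: w by rewrite opprD addNKr scaleNr opprK.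
rewrite dualBE op_comb !dualZ Ae.
have e1 : t * e w ^+ 2 <= eps.
  by rewrite /t mulrAC ler_pdivrMr// ler_wpM2l ?ltW//; lra.
have -> : t * zs w - (t * A z w + - t * (t * e w ^+ 2)) =
    t * (zs w - A z w + t * e w ^+ 2) by ring.
rewrite pmulr_rge0//; lra.
Qed.

Hypothesis ranA : range A `<=` range (@bidual_emb R X).

(** The functional [w] is invisible to the range of [A], which lies in [X], but not
to [e]. *)
Lemma quadratic_gap (w : dual (dual (dual X))) (s t c : R) :
  (forall z : X, w (bidual_emb z) = 0) -> w e = 1 ->
  (forall r : R, c <= r ^+ 2 - t * r + s * t) ->
  bidual_gap (op_fun A) c (s *: w, t *: e).
Proof.
move=> w0 we h x _ ->.
rewrite -[leRHS]/(dual_fun (bidual_emb x - s *: w) (A x - t *: e)) dualBE dualZE !dualB !dualZ we.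
have [y _ yx] := ranA (imageT A x).
rewrite -[X in s * (w X - _)]yx w0 /= Ae.
have := h (e x); lra.
Qed.

Lemma quadratic_not_type_D : ~ type_D (op_fun A).
Proof.
have [w [w0 we]] := functional_vanishing_on_X eX.
(* [r ^+ 2 - r + 1 >= 3 / 4]. *)
apply: (not_type_D (c := 1 / 2) _ (quadratic_gap (s := 1) (t := 1) w0 we _)) => // r.
by have := sqr_ge0 (r - 1 / 2); lra.
Qed.

Lemma quadratic_not_unique : ~ unique_bidual (op_fun A).
Proof.
have [w [w0 we]] := functional_vanishing_on_X eX.
(* Any two distinct points on the curve [s * t = 1] with [0 < t <= 4 * s] would do. *)
apply: (@not_unique_bidual _ _ _ (1 *: w, 1 *: e) (2 *: w, (1 / 2) *: e)).
- by move=> x _ y _ -> ->; exact: op_monotone.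
- by apply: quadratic_gap => // r; have := sqr_ge0 (r - 1 / 2); lra.
- by apply: quadratic_gap => // r; have := sqr_ge0 (r - 1 / 4); lra.
- rewrite -[ltLHS]/(dual_fun (1 *: w - 2 *: w) (1 *: e - (1 / 2) *: e)).
  by rewrite dualBE !dualZE !dualB !dualZ we; lra.
Qed.

End QuadraticOperator.

(** * The skew operator T *)

Section SkewOperator.
Variables (R : realType) (X : completeNormedModType R).
Variables (A : {linear dual X -> dual (dual X)}) (e : dual (dual X)).
Hypothesis eX : ~ range (@bidual_emb R X) e.
Hypothesis Ae : forall x : dual X, A x x = e x ^+ 2.
Variable B : dual X -> X.
Hypothesis BA : forall x, bidual_emb (B x) = A x.
Implicit Types (x y u v : dual X) (z : X).

(** The operator [T], written with the map [B] that represents [A] in [X]. *)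
Definition skew_rel : X -> set (dual X) := fun z => [set x | e x = 0 /\ z = - B x].
Notation T := skew_rel.

Lemma preE x y : y (B x) = A x y.
Proof. by rewrite -BA. Qed.

Lemma pre_comb x y (a : R) : B (x + a *: y) = B x + a *: B y.
Proof. by apply: emb_inj; rewrite linearD linearZ /= !BA linearD linearZ. Qed.

Lemma preN x : B (- x) = - B x.
Proof. by apply: emb_inj; rewrite linearN /= !BA linearN. Qed.

Lemma preB x y : B (x - y) = B x - B y.
Proof. by rewrite -[- y]scaleN1r pre_comb scaleN1r. Qed.

Lemma pre0 : B 0 = 0.
Proof. by have := preB 0 0; rewrite !subrr. Qed.

Lemma preZ x (a : R) : B (a *: x) = a *: B x.
Proof. by rewrite -[a *: x]add0r pre_comb pre0 add0r. Qed.

Lemma pre_self x : x (B x) = e x ^+ 2.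
Proof. by rewrite preE Ae. Qed.

(** On the kernel of [e] this is the skewness of [B]. *)
Lemma pre_polar x y : y (B x) = 2 * e x * e y - x (B y).
Proof. by have := quadratic_polar Ae x y; rewrite !preE; lra. Qed.

(** A vector of [X] orthogonal to the kernel of [e] is a multiple of [e], hence 0
because [e] is outside [X]. *)
Lemma skew_rel_orth x z : (forall v, e v = 0 -> v (z + B x) = 0) -> z = - B x.
Proof.
move=> h; have [r] := @dual_multiple _ _ e (bidual_emb (z + B x)) h.
move=> /(bidual_outside_scale eX)[_ /eqP].
by rewrite addr_eq0 => /eqP.
Qed.

Lemma skew_rel_skew z x : T z x -> x z = 0.
Proof. by move=> [ex ->]; rewrite dualN pre_self ex expr0n oppr0. Qed.

Lemma skew_rel_linear : linear_relation T.
Proof.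
split; first by split; rewrite ?dual0// pre0 oppr0.
move=> a z x z' x' [/= ex ->] [/= ex' ->]; split.
  by rewrite /= dualD dualZ ex ex' mulr0 addr0.
by rewrite /= (addrC (a *: x)) pre_comb opprD scalerN addrC.
Qed.

Lemma skew_rel_diff z x z' x' : T z x -> T z' x' -> T (z - z') (x - x').
Proof.
move=> Tz Tz'; have := skew_rel_linear.2 (-1) _ _ _ _ Tz' Tz.
by rewrite !scaleN1r ![- _ + _]addrC.
Qed.

Lemma skew_rel_monotone z x z' x' : T z x -> T z' x' -> 0 <= (x - x') (z - z').
Proof. by move=> Tz Tz'; rewrite (skew_rel_skew (skew_rel_diff Tz Tz')). Qed.

(** Relatedness to a skew linear relation forces the linear part of the pairing
to vanish, so [z = - B x]; what remains is [- e x ^+ 2 >= 0]. *)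
Lemma skew_rel_maximal : maximally_monotone T.
Proof.
apply: maximally_monotone_related.
  by move=> [z x] [z' x']; exact: skew_rel_monotone.
move=> [z x] h.
have hv v : e v = 0 -> v (z + B x) <= x z.
  move=> ev; have Tv : T (- B v) v by [].
  have : 0 <= (x - v) (z - - B v) := h (- B v, v) Tv.
  by rewrite dualBE opprK !dualD pre_self ev (pre_polar v x) ev; lra.
have z_eq : z = - B x.
  apply: skew_rel_orth.
  apply: (@linear_bounded_below _ _ (fun v => v (z + B x)) (fun v => e v = 0) (- x z)).
  - by move=> a v ev; rewrite dualZ ev mulr0.
  - by [].
  - by move=> v ev; have := hv (- v); rewrite dualNE dualN ev oppr0 => /(_ erefl); lra.
have h0 : 0 <= x z := hv 0 (dual0 e).
rewrite z_eq dualN pre_self in h0.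
split=> //; apply/eqP; rewrite -sqrf_eq0; apply/eqP.
by have := sqr_ge0 (e x); lra.
Qed.

(** The relation defining the adjoint says that [q - A x] vanishes on the kernel
of [e]. *)
Lemma skew_rel_adjoint : gra (adjoint T) =
  [set q | exists x (r : R), q = (A x - e x *: e + r *: e, x)].
Proof.
apply/seteqP; split=> [[q x] h|_ [x [r ->]] [z v] [ev ->]].
  have [|r qr] := @dual_multiple _ _ e (q - A x).
    move=> v ev; have : x (- B v) + - q v = 0 := h (- B v, v) (conj ev erefl).
    rewrite dualN (pre_polar v x) ev dualBE -preE; lra.
  exists x, (r + e x); congr pair.
  by rewrite scalerDl (addrC (r *: e)) addrA subrK -qr subrKC.
rewrite /= dualN (pre_polar v x) ev.
rewrite -[X in _ + X]/(- (A x v - e x * e v + r * e v)) ev -preE; lra.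
Qed.

(** The graph of [- T] lies in [{(B x, x)}], which is monotone and strictly larger. *)
Lemma skew_rel_opp_not_maximal : ~ maximally_monotone (op_opp T).
Proof.
move=> [_ maxT]; have [u eu] := bidual_outside_unit eX.
have : [set p : X * dual X | p.1 = B p.2] = gra (op_opp T).
  apply: maxT => [[z x] [z' x']|[z _] [x [/= ex ->] <-]] /=.
    by move=> -> ->; have := sqr_ge0 (e (x - x')); rewrite -pre_self preB.
  by rewrite preN.
move/seteqP => [/(_ (B u, u) erefl)] [v [ev _] vu] _.
rewrite /= in vu; move: eu; rewrite -vu dualN ev oppr0 => /eqP; by rewrite eq_sym oner_eq0.
Qed.

(** On the graph of [T] the pairing with this point is constant, equal to
[e u * (r - e u)]. *)
Lemma skew_rel_gap u (r c : R) :
  c <= e u * (r - e u) -> bidual_gap T c (- A u + r *: e, u).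
Proof.
move=> cu z x [ex ->].
rewrite -[leRHS]/((x - u) (- B x) - (- A u (x - u) + r * e (x - u))).
rewrite dualBE !dualN !dualB pre_self -!preE.
by rewrite (pre_polar x u) pre_self ex; lra.
Qed.

Lemma skew_rel_not_type_D : ~ type_D T.
Proof.
have [u eu] := bidual_outside_unit eX.
by apply: (not_type_D (c := 1) _ (@skew_rel_gap u 2 1 _)) => //; rewrite eu; lra.
Qed.

Lemma skew_rel_not_unique : ~ unique_bidual T.
Proof.
have [u eu] := bidual_outside_unit eX.
(* Both gaps are nonnegative, but the mutual pairing is [- (e u - e (2 *: u)) ^+ 2]. *)
apply: (@not_unique_bidual _ _ _ (- A u + 2 *: e, u) (- A (2 *: u) + 2 *: e, 2 *: u)).
- by move=> x xs y ys; exact: skew_rel_monotone.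
- by apply: skew_rel_gap; rewrite eu; lra.
- by apply: skew_rel_gap; rewrite dualZ eu; lra.
- rewrite -[ltLHS]/(dual_fun ((- A u + 2 *: e) - (- A (2 *: u) + 2 *: e)) (u - 2 *: u)).
  rewrite dualBE !dualDE !dualNE !dualZE !dualB !dualZ eu.
  by rewrite !op_scale Ae eu; lra.
Qed.

(** The supremum defining it is that of the linear functional
[v |-> v (z + B x)] on the kernel of [e]: either 0 or infinite. *)
Lemma skew_rel_fitzpatrick :
  fitzpatrick T = eindicator R [set p : X * dual X | p.1 = - B p.2].
Proof.
apply/funext => -[z x]; rewrite /eindicator; case: ifPn => [|].
  rewrite inE /= => ->; apply/eqP; rewrite eq_le; apply/andP; split.
    apply: ge_ereal_sup => _ [[_ v] [/= ev ->] <-]; rewrite lee_fin.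
    by rewrite !dualN pre_self (pre_polar v x) ev; lra.
  apply: ereal_sup_ubound; exists (0, 0); first exact: skew_rel_linear.1.
  by rewrite /= !dual0 subr0 addr0.
move=> zx; have [[v [ev vz]]|h] := pselect (exists v, e v = 0 /\ v (z + B x) != 0).
  apply/eqyP => M M0; apply: ereal_sup_ubound.
  have [w [ew wz]] : exists w, e w = 0 /\ w (z + B x) = M.
    exists ((M / v (z + B x)) *: v); rewrite dualZ ev mulr0; split=> //.
    by rewrite dualZE divfK.
  exists (- B w, w); first by split.
  rewrite /= !dualN pre_self (pre_polar w x) ew; congr EFin.
  by move: wz; rewrite dualD; lra.
exfalso; move/negP: zx; apply; rewrite inE /=; apply: skew_rel_orth => v ev.
by apply/eqP; apply: contrapT => /negP vz; apply: h; exists v.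
Qed.

(** At [(- B u, u)] with [e u = 1] the pairing with the graph is constantly -1, while
[u] is at distance at least [`|e|^-1] from the kernel of [e]. *)
Lemma skew_rel_not_type_BR : ~ type_BR T.
Proof.
have [u eu] := bidual_outside_unit eX.
have e0 : 0 < `|e|.
  rewrite normr_gt0; apply/eqP => e0; move: eu; rewrite e0 => /eqP.
  by rewrite eq_sym oner_eq0.
move=> /(_ (- B u) u (2 * `|e|) `|e|^-1) [|||b [x [[ex _] _ xu]]].
- by rewrite mulr_gt0.
- by rewrite invr_gt0.
- apply: (@lt_le_trans _ _ (- 1)%:E).
    by rewrite lte_fin mulfK ?gt_eqF//; lra.
  apply: le_ereal_inf_tmp => _ [[_ x] [/= ex ->] <-]; rewrite lee_fin.
  rewrite -[leRHS]/(u (- B u - - B x) - x (- B u - - B x)).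
  by rewrite !dualB !dualN !pre_self (pre_polar x u) ex eu; lra.
have := dual_normP e (u - x); rewrite dualB eu ex subr0 normr1 leNgt => /negP; apply.
by rewrite mulrC -ltr_pdivlMr// mul1r.
Qed.

(** Off the set [C] the conjugate is infinite: finiteness would force
[z + B x = 2 * e x *: e] in the bidual, hence [z = - B x]. *)
Lemma fitzpatrick_BC : BC_function (fitzpatrick T).
Proof.
rewrite skew_rel_fitzpatrick.
set C := [set p | _].
have C0 : C (0, 0) by rewrite /C /= pre0 oppr0.
have inC p : C p -> eindicator R C p = 0%E.
  by move=> Cp; rewrite /eindicator ifT// inE.
have outC p : ~ C p -> eindicator R C p = +oo%E.
  by move=> Cp; rewrite /eindicator ifF//; apply/negP; rewrite inE.
split.
- split=> [p|]; first by rewrite /eindicator; case: ifP.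
  by exists (0, 0); rewrite /efdom /= inC.
- move=> p q t t0 t1.
  have [Cp|nCp] := pselect (C p); last first.
    rewrite (outC p)// gt0_muley ?lte_fin// addye ?leey//.
    by rewrite /eindicator; case: ifP => _; rewrite ?mule0// gt0_muley// lte_fin; lra.
  have [Cq|nCq] := pselect (C q); last first.
    by rewrite (inC p)// (outC q)// mule0 add0e gt0_muley ?leey// lte_fin; lra.
  have Ct : C (t *: p + (1 - t) *: q).
    by rewrite /C /= Cp Cq pre_comb preZ opprD !scalerN.
  by rewrite !inC// !mule0 adde0.
- move=> z x; split; last first.
    have [Cp|nCp] := pselect (C (z, x)); last by rewrite outC ?leey.
    by rewrite inC// lee_fin (Cp : z = - B x) dualN pre_self oppr_le0 sqr_ge0.
  have [Cp|nCp] := pselect (C (z, x)).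
    rewrite inC//; apply: ereal_sup_ubound; exists (0, 0) => //.
    by rewrite inC// !dual0 addr0 sube0.
  rewrite outC// leye_eq; apply/eqP/eqyP => M M0; apply: ereal_sup_ge.
  have [[v vz]|h] := pselect (exists v, v z + v (B x) - 2 * e x * e v != 0).
    pose a := M / (v z + v (B x) - 2 * e x * e v).
    exists ((x (- B (a *: v)) + (a *: v) z)%:E - 0)%E.
      by exists (- B (a *: v), a *: v) => //; rewrite inC.
    rewrite sube0 lee_fin dualN (pre_polar (a *: v) x) !dualZE dualZ.
    by have := divfK vz M; rewrite -/a; lra.
  exfalso; apply: nCp.
  have h' v : v z + v (B x) = 2 * e x * e v.
    apply/eqP; rewrite -subr_eq0; apply: contrapT => /negP vz.
    by apply: h; exists v.
  apply: skew_rel_orth => v ev; rewrite dualD h' ev mulr0//.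
Qed.

End SkewOperator.

(** * Sums of T with a subdifferential: counterexamples *)

Section Counterexamples.
Variables (R : realType) (X : completeNormedModType R).
Variables (A : {linear dual X -> dual (dual X)}) (cA : continuous A).
Variables (e : dual (dual X)).
Hypothesis eX : ~ range (@bidual_emb R X) e.
Hypothesis Ae : forall x : dual X, A x x = e x ^+ 2.
Variable B : dual X -> X.
Hypothesis BA : forall x, bidual_emb (B x) = A x.
Variable f : X -> \bar R.
Hypotheses (fproper : eproper f) (flsc : lower_semicontinuous f) (fconv : econvex f).
Notation fs := (fenchel_conj f).
Notation fss := (fenchel_conj fs).
Notation T := (skew_rel e B).

Lemma conic_hull_domains :
  conic_hull (minkowski_sub (snd @` efdom (fitzpatrick T))
    (snd @` efdom (fun p : X * dual X => (f p.1 + fs p.2)%E))) = setT.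
Proof.
apply/seteqP; split=> // y _; exists 1; first exact: ltr01.
have [_ [x1 fx1]] := fproper.
have [_ [y1 fsy1]] := fenchel_conj_proper fproper flsc fconv.
exists y; last by rewrite scale1r.
exists (y + y1); last exists y1; last by rewrite addrK.
- exists (- B (y + y1), y + y1) => //; rewrite /efdom /=.
  by rewrite (skew_rel_fitzpatrick eX Ae BA) /eindicator ifT// inE.
- by exists (x1, y1) => //; rewrite /efdom /= fin_numD fx1.
Qed.

(** The inf-convolution is [f (x + B y) + f^* y], and two Fenchel-Young
inequalities bound its conjugate at [(y0, v0)] by the left-hand side of the
hypothesis, which is below [y0 v0]. *)
Lemma inf_conv_not_BC (v0 : X) (y0 : dual X) :
  (fs y0 + fss (bidual_emb v0 - lin_adjoint cA y0)%R < (y0 v0)%:E)%E ->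
  ~ BC_function (inf_conv1 (fitzpatrick T) (fun p : X * dual X => (f p.1 + fs p.2)%E)).
Proof.
move=> hlt [_ _ /(_ v0 y0)[h1 h2]].
have fsproper := fenchel_conj_proper fproper flsc fconv.
have fssN := fenchel_conj_Nninfty fsproper (bidual_emb v0 - lin_adjoint cA y0).
have := le_trans h2 h1; rewrite leNgt => /negP; apply; apply: le_lt_trans hlt.
have := fsproper.1 y0; move: fssN.
case cE : (fss _) => [c| |]//; case bE : (fs y0) => [b| |]// _ _; rewrite ?leey//.
apply: ge_ereal_sup => _ [[x y] _ <-] /=; rewrite -EFinD.
suff : ((y0 x + y v0 - (b + c))%:E <=
    inf_conv1 (fitzpatrick T) (fun p => (f p.1 + fs p.2)%E) (x, y))%E.
  case: (inf_conv1 _ _ _) => [i| |]//; rewrite ?leeNy_eq//.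
    by rewrite -EFinB !lee_fin; lra.
  by rewrite leNye.
apply: le_ereal_inf_tmp => _ [u _ <-] /=.
have [fN _] := fproper; have [fsN _] := fsproper.
rewrite (skew_rel_fitzpatrick eX Ae BA) /eindicator; case: ifPn => [|_]; last first.
  by rewrite addye ?leey// adde_eq_ninfty negb_or fN fsN.
rewrite inE /= => ->; rewrite add0e opprK.
have := fN (x + B y); have := fsN y.
case fyE : (fs y) => [d| |]//; case fE : (f _) => [a| |]// _ _; rewrite ?leey//.
have : y0 (x + B y) <= a + b by apply: (@fenchel_young_le _ _ f); rewrite ?fE ?bE.
have : (bidual_emb v0 - lin_adjoint cA y0) y <= d + c.
  by apply: (@fenchel_young_le _ _ fs); rewrite ?fyE ?cE.
by rewrite -EFinD lee_fin dualD (preE BA) dualBE /=; lra.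
Qed.

(** At [lin_adjoint u] the operator [T] has gap [e u ^+ 2] ([skew_rel_gap] with
[r = 2 * e u]).  Choosing [y] as an approximate subgradient of [f^**] there, the
subdifferential consumes at most half of this gap. *)
Lemma sum_not_type_D u : fss (lin_adjoint cA u) \is a fin_num -> e u != 0 ->
  ~ type_D (op_add T (subdifferential f)).
Proof.
move=> fssu eu; have eu2 : 0 < e u ^+ 2 by rewrite exprn_even_gt0.
set c := fine (fss (lin_adjoint cA u)).
have cE : fss (lin_adjoint cA u) = c%:E by rewrite fineK.
have [_ [y _ <-] hy] : exists2 k : \bar R,
    [set ((lin_adjoint cA u y)%:E - fs y)%E | y in setT] k &
    ((c - e u ^+ 2 / 2)%:E < k)%E.
  by apply: ereal_sup_gt; rewrite -/(fss _) cE lte_fin; lra.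
have [b bE] : exists b, fs y = b%:E.
  have := fenchel_conj_Nninfty fproper y; move: hy.
  by case: (fs y) => [b| |]// _ _; exists b.
rewrite bE -EFinB lte_fin in hy.
apply: (@not_type_D _ _ _ (e u ^+ 2 / 2) (lin_adjoint cA u, u + y)).
  by rewrite divr_gt0.
move=> z _ [v Tv [b' zb' <-]].
have gap : e u ^+ 2 <= (bidual_emb z - lin_adjoint cA u) (v - u).
  rewrite (lin_adjointE cA Ae) [_ - A u]addrC.
  by apply: (@skew_rel_gap _ _ A e Ae B BA u (2 * e u)) Tv; rewrite expr2; lra.
have fz := fineK (subdifferential_fin fproper zb').
have h1 : y z <= fine (f z) + b.
  by apply: (@fenchel_young_le _ _ f); rewrite ?fz ?bE.
have h2 : lin_adjoint cA u b' <= (b' z - fine (f z)) + c.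
  by apply: (@fenchel_young_le _ _ fs); [exact: fenchel_conj_subdifferential|rewrite cE].
rewrite -[leRHS]/(dual_fun (bidual_emb z - lin_adjoint cA u) (v + b' - (u + y))).
have -> : v + b' - (u + y) = (v - u) + (b' - y) by rewrite opprD addrACA.
rewrite dualD; move: gap; move: (_ (v - u)) => k hk.
rewrite dualBE [lin_adjoint cA u _]dualB.
rewrite -[bidual_emb z _]/(b' z - y z); lra.
Qed.

End Counterexamples.

(** * Sums of T with a subdifferential: maximality *)

(** For [y] in [D] close to [z] and [d := y - x0], the proximal step of
[prox_line] yields [x = x0 + s *: d] in [D] and [phi] in [dg(x)] with
[phi d = 1 - s].  As [x - z = (y - z) - (1 - s) *: d], the hypothesis reads
[eps + (1 - s) ^+ 2 <= phi (y - z)], which is small because [phi] is bounded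
independently of [y].  So [eps = 0], [x] tends to [z], and the subgradient
inequality at [x0] passes to the limit. *)
Lemma minimiser_on_subspace (R : realType) (Z : normedModType R) (g : Z -> \bar R)
    (D : set Z) (x0 z : Z) (delta M eps : R) :
  eproper g -> lower_semicontinuous g -> econvex g ->
  (forall (a : R) x y, D x -> D y -> D (a *: x + y)) -> D x0 ->
  0 < delta -> (forall h, `|h| <= delta -> (g (x0 + h)%R <= M%:E)%E) ->
  (forall eta : R, 0 < eta -> exists2 y, D y & `|z - y| < eta) ->
  0 <= eps ->
  (forall x b, D x -> subdifferential g x b -> eps <= b (x - z)) ->
  eps = 0 /\ (g z <= g x0)%E.
Proof.
move=> gproper glsc gconv DD Dx0 delta0 gM zD eps0 hb.
have [gN _] := gproper.
have [b0 b0P] := subdifferentiable gconv delta0 gM (gN x0).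
pose g0 := fine (g x0).
have g0E : g x0 = g0%:E by rewrite /g0 fineK// (subdifferential_fin gproper b0P).
pose L := `|z - x0| + 1.
have L0 : 0 < L by rewrite ltr_wpDl.
pose beta := `|b0| * L.
have beta0 : 0 <= beta by rewrite mulr_ge0// ltW.
(* [(beta + 1) ^+ 2 / 4] is the maximum of [(beta + 1) * s - s ^+ 2]. *)
pose K := (M - g0 + (beta + 1) ^+ 2 / 4) / delta.
have g0M : g0 <= M.
  by have := gM 0; rewrite normr0 addr0 g0E lee_fin => /(_ (ltW delta0)).
have K0 : 0 <= K.
  apply: divr_ge0; last exact: ltW.
  by rewrite addr_ge0 ?subr_ge0// divr_ge0// sqr_ge0.
have key eta : 0 < eta -> eta <= 1 -> exists s x, [/\ (1 - s) ^+ 2 + eps <= K * eta,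
    `|x - z| <= eta + `|1 - s| * L & (g x <= (g0 + s * (1 - s))%:E)%E].
  move=> eta0 eta1; have [y Dy zy] := zD _ eta0.
  pose d := y - x0.
  have dL : `|d| <= L.
    by have := ler_distD z y x0; rewrite /L (distrC y z) -/d; lra.
  have [s [phi [sphi phid]]] := prox_line d gproper glsc gconv delta0 gM.
  pose x := x0 + s *: d.
  have Dd : D d by rewrite /d addrC -scaleN1r; exact: DD.
  have Dx : D x by rewrite /x addrC; exact: DD.
  have gx := fineK (subdifferential_fin gproper sphi).
  rewrite -/x in gx sphi.
  have gx_ge : g0 + s * b0 d <= fine (g x).
    have := b0P x; rewrite -gx g0E -EFinD lee_fin.
    by rewrite (_ : x - x0 = s *: d) ?dualZ; [lra|rewrite /x addrC addKr].
  have bd : `|b0 d| <= beta.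
    by apply: (le_trans (dual_normP _ _)); rewrite ler_wpM2l.
  have phix0 : phi (x0 - x) = - (s * (1 - s)).
    by rewrite /x opprD addNKr dualN dualZ phid.
  have phib w : `|phi w| <= K * `|w|.
    apply: dual_bound => // h hd.
    have := le_trans (sphi (x0 + h)) (gM _ hd); rewrite -gx -EFinD lee_fin.
    rewrite addrAC dualD phix0 => h1.
    have h2 : - (s * b0 d) <= `|s| * beta.
      by rewrite -mulrN (le_trans (ler_norm _))// normrM normrN ler_wpM2l.
    have h3 : s <= `|s| by exact: ler_norm.
    have h4 : `|s| ^+ 2 = s ^+ 2 by rewrite real_normK// num_real.
    have := sqr_ge0 (`|s| - (beta + 1) / 2); nra.
  exists s, x.
  have xz : x - z = (y - z) - (1 - s) *: d.
    rewrite scalerBl scale1r opprB [s *: d - d]addrC /x {2}/d opprB addrA.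
    by rewrite [y - z + _]addrC subrKA addrAC.
  split.
  - have := hb _ _ Dx sphi; rewrite xz dualB dualZ phid.
    have := ler_norm (phi (y - z)); have := phib (y - z).
    have : K * `|y - z| <= K * eta.
      by rewrite ler_wpM2l// distrC ltW.
    rewrite expr2; lra.
  - rewrite xz; apply: (le_trans (ler_normB _ _)); rewrite normrZ distrC.
    by apply: lerD; [exact: ltW|rewrite ler_wpM2l].
  - rewrite -gx lee_fin; have := sphi x0; rewrite -gx g0E -EFinD lee_fin phix0; lra.
have eps_le : eps <= 0.
  rewrite leNgt; apply/negP => eps1.
  pose eta := Num.min 1 (eps / (2 * (K + 1))).
  have K1 : 0 < 2 * (K + 1) by lra.
  have eta0 : 0 < eta by rewrite /eta lt_min ltr01 divr_gt0.
  have eta1 : eta <= 1 by rewrite /eta ge_min lexx.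
  have [s [x [h _ _]]] := key _ eta0 eta1.
  have : eta * (2 * (K + 1)) <= eps.
    by rewrite -ler_pdivlMr// /eta ge_min lexx orbT.
  have := sqr_ge0 (1 - s); nra.
split; first lra.
rewrite leNgt; apply/negP; rewrite g0E => /ereal_between[a g0a ag].
have [rho rho0 zrho] := lsc_ball glsc ag.
(* With [`|1 - s| <= tau] the point [x] falls in the ball where [g > a], whereas
   [g x <= g0 + tau <= a]. *)
pose tau := Num.min (a - g0) (rho / (2 * L)).
have L2 : 0 < 2 * L by lra.
have tau0 : 0 < tau by rewrite /tau lt_min subr_gt0 g0a divr_gt0.
have tau1 : tau <= a - g0 by rewrite /tau ge_min lexx.
have tau2 : tau * L <= rho / 2.
  have : tau * (2 * L) <= rho by rewrite -ler_pdivlMr// /tau ge_min lexx orbT.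
  lra.
pose eta := Num.min (Num.min 1 (rho / 4)) (tau ^+ 2 / (K + 1)).
have K1 : 0 < K + 1 by lra.
have eta0 : 0 < eta by rewrite /eta !lt_min ltr01 !divr_gt0// exprn_gt0.
have eta1 : eta <= 1 by rewrite /eta !ge_min lexx.
have eta2 : eta <= rho / 4 by rewrite /eta !ge_min lexx orbT.
have eta3 : eta * (K + 1) <= tau ^+ 2.
  by rewrite -ler_pdivlMr// /eta ge_min lexx orbT.
have [s [x [h xz gx]]] := key _ eta0 eta1.
have st : `|1 - s| <= tau.
  rewrite -ler_sqr ?nnegrE ?normr_ge0 ?ltW// real_normK ?num_real//; lra.
have : (a%:E < g x)%E.
  apply: zrho; apply: (le_lt_trans xz).
  have : `|1 - s| * L <= tau * L by rewrite ler_wpM2r// ltW.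
  lra.
rewrite ltNge => /negP; apply; apply: (le_trans gx); rewrite lee_fin.
have := ler_norm (1 - s); have := sqr_ge0 (1 - s); rewrite expr2; lra.
Qed.

Section SumTheorem.
Variables (R : realType) (X : completeNormedModType R).
Variables (A : {linear dual X -> dual (dual X)}) (e : dual (dual X)).
Hypothesis eX : ~ range (@bidual_emb R X) e.
Hypothesis Ae : forall x : dual X, A x x = e x ^+ 2.
Variable B : dual X -> X.
Hypothesis BA : forall x, bidual_emb (B x) = A x.
Variable f : X -> \bar R.
Hypotheses (fproper : eproper f) (flsc : lower_semicontinuous f) (fconv : econvex f).
Notation T := (skew_rel e B).
Notation Tf := (op_add T (subdifferential f)).

(** The annihilator of the domain of [T] is [T 0]. *)
Lemma domain_annihilator (phi : dual X) :
  (forall v, e v = 0 -> phi (B v) = 0) -> e phi = 0 /\ B phi = 0.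
Proof.
move=> phi0; have Bphi : B phi = 0.
  apply/eqP; rewrite -oppr_eq0 eq_sym; apply/eqP.
  apply: (skew_rel_orth eX) => v ev.
  by rewrite add0r (pre_polar Ae BA) ev phi0// mulr0 subr0.
split=> //; apply/eqP; rewrite -sqrf_eq0 -(pre_self Ae BA) Bphi dual0//.
Qed.

(** Near [x0] subgradients exist and are bounded, so relatedness bounds
[v (z + B zs)] when [B v] is small and [e v = 0].  The resulting bounded functional
[B v |-> v (z + B zs)] extends to some [y], and then [z + B (zs + y)] is
orthogonal to the kernel of [e]. *)
Lemma related_in_range x0 v0 (delta M : R) z zs :
  T x0 v0 -> 0 < delta ->
  (forall h, `|h| <= delta -> (f (x0 + h)%R <= M%:E)%E) ->
  (forall x v b, T x v -> subdifferential f x b -> 0 <= (zs - (v + b)) (z - x)) ->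
  exists u, z = - B u.
Proof.
move=> [ev0 x0E] delta0 fM h.
have [fN _] := fproper.
have [b0 b0P] := subdifferentiable fconv delta0 fM (fN x0).
pose f0 := fine (f x0).
have f0E : f x0 = f0%:E by rewrite /f0 fineK// (subdifferential_fin fproper b0P).
pose rho := delta / 2.
have rho0 : 0 < rho by rewrite /rho; lra.
pose K := (M - (f0 - `|b0| * rho)) / rho.
have K0 : 0 <= K.
  apply: divr_ge0; last exact: ltW.
  have : f0 <= M.
    by have := fM 0; rewrite normr0 addr0 f0E lee_fin => /(_ (ltW delta0)).
  have : 0 <= `|b0| * rho by rewrite mulr_ge0// ltW.
  lra.
have local k : `|k| <= rho -> exists2 b, subdifferential f (x0 + k) b &
    forall x, `|b x| <= K * `|x|.
  move=> kr; have fMk l : `|l| <= rho -> (f (x0 + k + l)%R <= M%:E)%E.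
    move=> lr; rewrite -addrA; apply: fM; apply: (le_trans (ler_normD _ _)).
    by move: kr lr; rewrite /rho; lra.
  have [b bP] := subdifferentiable fconv rho0 fMk (fN (x0 + k)).
  exists b => // x; apply: dual_bound => // l lr.
  have := le_trans (bP (x0 + k + l)) (fMk _ lr).
  have := b0P (x0 + k).
  rewrite -(fineK (subdifferential_fin fproper bP)) f0E -!EFinD !lee_fin.
  have addl (a c : X) : a + c - a = c by rewrite addrC addKr.
  rewrite !addl.
  have := ler_norm (b0 (- k)); rewrite dualN normrN => h1.
  have h2 := dual_normP b0 k.
  have : `|b0| * `|k| <= `|b0| * rho by rewrite ler_wpM2l.
  lra.
pose C := zs z - v0 (z + B zs) + K * (`|z - x0| + rho).
have bound v : e v = 0 -> `|B v| <= rho -> v (z + B zs) <= C.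
  move=> ev Bv; have [|b xb bK] := local (- B v); first by rewrite normrN.
  have Tx : T (x0 - B v) (v0 + v).
    split; first by rewrite /= dualD ev0 ev addr0.
    by rewrite -[v in RHS]scale1r (pre_comb BA) scale1r opprD x0E.
  have := h _ _ _ Tx xb; set x := x0 - B v.
  rewrite dualBE dualDE.
  have xE : x = - B (v0 + v) by case: Tx.
  have e0 : e (v0 + v) = 0 by case: Tx.
  have e1 : zs (z - x) = zs z - (v0 + v) (B zs).
    by rewrite dualB xE dualN (pre_polar Ae BA) e0; lra.
  have e2 : (v0 + v) (z - x) = (v0 + v) z.
    by rewrite dualB xE dualN (pre_self Ae BA) e0; lra.
  rewrite e1 e2 !dualDE => h1.
  have h2 : - b (z - x) <= K * `|z - x|.
    by rewrite -dualN -(normrN (z - x)); apply: (le_trans (ler_norm _)).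
  have h3 : K * `|z - x| <= K * (`|z - x0| + rho).
    rewrite ler_wpM2l//; have -> : z - x = (z - x0) + B v.
      by rewrite /x opprB [B v - x0]addrC addrA.
    by rewrite (le_trans (ler_normD _ _))// lerD2l.
  by rewrite /C !dualD; lra.
pose G := [set q : X * R^o | exists v, e v = 0 /\ q = (B v, v (z + B zs))].
have Gl : linrel G.
  split; first by exists 0; rewrite dual0 (pre0 BA).
  move=> a _ _ _ _ [v [ev [-> ->]]] [w [ew [-> ->]]].
  exists (w + a *: v); rewrite dualD dualZ ev ew mulr0 addr0; split=> //.
  by rewrite (pre_comb BA) addrC; congr pair; rewrite dualDE dualZE addrC.
have GC x r : G (x, r) -> `|x| <= rho -> r <= C.
  by move=> [v [ev [-> ->]]]; exact: bound.
have C0 : 0 <= C by apply: (GC 0 0 Gl.1); rewrite normr0 ltW.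
have [|y [yG _]] := @norm_hahn_banach _ _ (C / rho) G _ Gl (linrel_bound rho0 Gl GC).
  by rewrite divr_ge0// ltW.
exists (zs + y); apply: (skew_rel_orth eX) => v ev.
have : y (B v) = v (z + B zs) by apply: yG; exists v.
rewrite (pre_polar Ae BA v y) ev -[y in B (zs + y)]scale1r (pre_comb BA) scale1r.
by rewrite !dualD; lra.
Qed.

(** Together with [related_in_range] this puts [z] in the closure of the domain
of [T], whether or not [e u = 0]. *)
Lemma domain_approx u (eta : R) : 0 < eta ->
  exists2 y, dom_op T y & `|- B u - y| < eta.
Proof.
apply: annihilator_approx.
- by exists 0; exact: (skew_rel_linear e BA).1.
- move=> a x y [v xv] [w yw]; exists (a *: v + w).
  exact: (skew_rel_linear e BA).2.
- move=> phi phi0; have [ephi Bphi] : e phi = 0 /\ B phi = 0.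
    apply: domain_annihilator => v ev; have := phi0 (- B v); rewrite dualN => h.
    by apply/eqP; rewrite -oppr_eq0 h//; exists v.
  by rewrite dualN (pre_polar Ae BA) ephi Bphi dual0; lra.
Qed.

(** Tilting [f] by [zs - u] removes [T] from the relation and reduces the claim to
[minimiser_on_subspace]. *)
Lemma sum_maximally_monotone x0 v0 (delta M : R) :
  T x0 v0 -> 0 < delta ->
  (forall h, `|h| <= delta -> (f (x0 + h)%R <= M%:E)%E) ->
  maximally_monotone Tf.
Proof.
move=> Tx0 delta0 fM; apply: maximally_monotone_related.
  move=> [x y] [x' y'] [v xv [b xb vb]] [v' xv' [b' xb' vb']] /=.
  rewrite /= in xv xb vb xv' xb' vb'.
  have := skew_rel_monotone Ae BA xv xv'; have := subdifferential_monotone fproper xb xb'.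
  move=> h1 h2; rewrite -[leRHS]/(dual_fun (y - y') (x - x')).
  have -> : y - y' = (v - v') + (b - b') by rewrite -vb -vb' opprD addrACA.
  exact: addr_ge0.
move=> [z zs] h0.
have h x v b : T x v -> subdifferential f x b -> 0 <= (zs - (v + b)) (z - x).
  by move=> xv xb; apply: (h0 (x, v + b)); exists v => //; exists b.
have [u zE] := related_in_range Tx0 delta0 fM h.
pose cs := zs - u.
pose g := tilt f cs.
have gproper : eproper g by exact: tilt_proper.
have glsc : lower_semicontinuous g by exact: tilt_lsc.
have gconv : econvex g by exact: tilt_convex.
pose M' := M + `|cs| * (`|x0| + delta).
have gM k : `|k| <= delta -> (g (x0 + k)%R <= M'%:E)%E.
  move=> kd; rewrite tilt_le; apply: (le_trans (fM _ kd)); rewrite lee_fin.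
  have := ler_norm (- cs (x0 + k)); rewrite normrN => h1.
  have h2 := dual_normP cs (x0 + k).
  have : `|cs| * `|x0 + k| <= `|cs| * (`|x0| + delta).
    by rewrite ler_wpM2l// (le_trans (ler_normD _ _))// lerD2l.
  by rewrite /M'; lra.
(* The contribution of [T] is constant: [(u - v) (z - x) = - e u ^+ 2]. *)
have gap x b : dom_op T x -> subdifferential g x b -> e u ^+ 2 <= b (x - z).
  move=> [v xv] /tilt_subdifferential xb; have := h _ _ _ xv xb.
  have -> : zs - (v + (b + cs)) = (u - v) - b.
    apply/eqP; rewrite subr_eq addrA [u - v - b + v]addrAC subrK addrA subrK.
    by rewrite /cs subrKC.
  rewrite dualBE; have [ev xE] := xv.
  have -> : (u - v) (z - x) = - e u ^+ 2.
    have -> : z - x = - B (u - v) by rewrite (preB BA) zE xE opprB opprK addrC.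
    by rewrite dualN (pre_self Ae BA) dualB ev subr0.
  by rewrite !dualB; lra.
have Dlin a x y : dom_op T x -> dom_op T y -> dom_op T (a *: x + y).
  by move=> [v xv] [w yw]; exists (a *: v + w); exact: (skew_rel_linear e BA).2.
have zD (eta : R) : 0 < eta -> exists2 y, dom_op T y & `|z - y| < eta.
  by rewrite zE; exact: domain_approx.
have min x r : dom_op T x -> 0 < r ->
    (exists N, forall k, `|k| <= r -> (g (x + k)%R <= N%:E)%E) ->
    e u ^+ 2 = 0 /\ (g z <= g x)%E.
  move=> Dx r0 [N gN].
  by apply: (minimiser_on_subspace gproper glsc gconv Dlin Dx r0 gN zD _ gap); exact: sqr_ge0.
have Dx0 : dom_op T x0 by exists v0.
have [/eqP eu gz] : e u ^+ 2 = 0 /\ (g z <= g x0)%E.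
  by apply: (min x0 delta) => //; exists M'.
rewrite sqrf_eq0 in eu; move/eqP: eu => eu.
have Dz : dom_op T z by exists u.
pose c := fine (g z).
have cE : g z = c%:E.
  rewrite /c fineK// fin_numE gproper.1/= lt_eqF//; apply: le_lt_trans gz _.
  by have := gM 0; rewrite normr0 addr0 => /(_ (ltW delta0))/le_lt_trans -> //; rewrite ltry.
have Gl : linrel [set q : X * R^o | dom_op T q.1 /\ q.2 = 0].
  split; first by split=> //; exists 0; exact: (skew_rel_linear e BA).1.
  by move=> a x r y s [Dx /= ->] [Dy /= ->]; split; [exact: Dlin|rewrite /= mulr0 addr0].
(* A point of [D] in the domain of [g] is a limit of points [t *: x0 + (1 - t) *: w]
   around which [g] is bounded, and [z] does better than each of those. *)
have cmin x r s : dom_op T x /\ r = 0 -> (g (x0 + x)%R <= s%:E)%E -> c + r <= s.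
  move=> [Dx ->] gs; rewrite addr0; apply/ler_addgt0Pl => eps eps0.
  have Dw : dom_op T (x0 + x) by rewrite -[x0]scale1r; exact: Dlin.
  pose t := Num.min (1 / 2) (eps / (`|M' - s| + 1)).
  have k0 : 0 < `|M' - s| + 1 by rewrite ltr_wpDl.
  have t0 : 0 < t by rewrite /t lt_min !divr_gt0.
  have t1 : t < 1 by rewrite /t gt_min; apply/orP; left; lra.
  have te : t * (`|M' - s| + 1) <= eps.
    by rewrite -ler_pdivlMr// /t ge_min lexx orbT.
  have near k : `|k| <= t * delta ->
      (g (t *: x0 + (1 - t) *: (x0 + x) + k)%R <= (t * M' + (1 - t) * s)%R%:E)%E.
    move=> kt; have kd : `|t^-1 *: k| <= delta.
      by rewrite normrZ gtr0_norm ?invr_gt0// ler_pdivrMl.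
    have := econvex_le gconv t0 t1 (gM _ kd) gs; congr (g _ <= _)%E.
    by rewrite scalerDr scalerA mulfV ?gt_eqF// scale1r addrAC.
  have Dp : dom_op T (t *: x0 + (1 - t) *: (x0 + x)).
    apply: (Dlin _ _ _) => //; rewrite -[(1 - t) *: _]addr0; apply: Dlin => //.
    by exists 0; exact: (skew_rel_linear e BA).1.
  have td : 0 < t * delta by rewrite mulr_gt0.
  have [_ gzp] := min _ _ Dp td (ex_intro _ _ near).
  have := near 0; rewrite normr0 addr0 => /(_ (ltW td))/(le_trans gzp).
  rewrite cE lee_fin.
  have := ler_wpM2l (ltW t0) (ler_norm (M' - s)); lra.
have [phi [phi0 phiP]] := convex_extension gconv delta0 gM Gl cmin.
have {}phi0 x : dom_op T x -> phi x = 0 by move=> Dx; exact: phi0.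
have /tilt_subdifferential zb : subdifferential g z phi.
  move=> y; have := phiP (y - x0).
  by rewrite subrKC !dualB (phi0 _ Dx0) (phi0 _ Dz) cE EFinD addeC.
have [ephi Bphi] : e phi = 0 /\ B phi = 0.
  apply: domain_annihilator => v ev; have := phi0 (- B v); rewrite dualN => h1.
  by apply/eqP; rewrite -oppr_eq0 h1//; exists v.
exists (u - phi).
  by split; [rewrite /= dualB eu ephi subrr|rewrite (preB BA) Bphi subr0].
exists (phi + cs) => //.
by rewrite addrA subrK /cs subrKC.
Qed.

Lemma sum_maximally_monotone_interior :
  dom_op T `&` (dom_op (subdifferential f))° !=set0 -> maximally_monotone Tf.
Proof.
move=> [x0 [[v0 Tx0] /nbhs_ballP[rho /= rho0 rhoP]]].
have [|delta [M [delta0 fM]]] := convex_bounded_near flsc fconv rho0 (x0 := x0).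
  move=> h hr; have [|b xb] := rhoP (x0 + h).
    by rewrite -ball_normE /= opprD addNKr normrN.
  by have := subdifferential_fin fproper xb; rewrite fin_numE => /andP[].
exact: sum_maximally_monotone Tx0 delta0 fM.
Qed.

Lemma sum_maximally_monotone_finite : efdom (fenchel_conj (fenchel_conj f)) = setT ->
  maximally_monotone Tf.
Proof.
move=> fssT; have ffin x : f x != +oo%E.
  apply/eqP => fx; have := fenchel_moreau fproper flsc fconv x; rewrite fx leye_eq.
  have : efdom (fenchel_conj (fenchel_conj f)) (bidual_emb x) by rewrite fssT.
  by rewrite /efdom /= fin_numE => /andP[_ /negbTE ->].
have [delta [M [delta0 fM]]] :=
  convex_bounded_near flsc fconv ltr01 (x0 := 0) (fun h _ => ffin (0 + h)).
exact: (sum_maximally_monotone (skew_rel_linear e BA).1 delta0 fM).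
Qed.

End SumTheorem.

(** * The theorem *)

Unset Implicit Arguments.

Theorem theorem3p6 (R : realType) (X : completeNormedModType R)
    (A : {linear dual X -> dual (dual X)}) (cA : continuous A)
    (ranA : range A `<=` range (@bidual_emb R X))
    (e : dual (dual X)) (eX : ~ range (@bidual_emb R X) e)
    (Ae : forall xs : dual X, A xs xs = e xs ^+ 2)
    (f : X -> \bar R) (f_proper : eproper f)
    (f_lsc : lower_semicontinuous f) (f_convex : econvex f) :
  let Astar : dual X -> dual (dual X) := lin_adjoint cA in
  let P := symmetric_part cA in
  let S := skew_part cA in
  let T : X -> set (dual X) :=
    fun x => [set xs : dual X | e xs = 0 /\ bidual_emb x = - S xs] in
  let fs := fenchel_conj f in
  let fss := fenchel_conj fs in
  let F : X * dual X -> \bar R := fun p => (f p.1 + fs p.2)%E in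
  let F_T := fitzpatrick T in
  let C := [set p : X * dual X | bidual_emb p.1 = - A p.2] in
  let Tf := op_add T (subdifferential f) in
  gra T = [set p | e p.2 = 0 /\ bidual_emb p.1 = - A p.2] /\
  (* i *)
  [/\ maximally_monotone (op_fun A), ~ type_D (op_fun A) &
      ~ unique_bidual (op_fun A)] /\
  (* ii *)
  (forall xs : dual X, P xs = e xs *: e) /\
  (* iii *)
  (maximally_monotone T /\ skew_op T) /\
  (* iv *)
  gra (adjoint T) = [set q | exists (xs : dual X) (r : R),
                               q = (S xs + r *: e, xs)] /\
  (* v *)
  ~ maximally_monotone (op_opp T) /\
  (* vi *)
  ~ type_D T /\
  (* vii *)
  F_T = eindicator R C /\
  (* viii *)
  ~ unique_bidual T /\
  (* ix *)
  ~ type_BR T /\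
  (* x *)
  (dom_op T `&` (dom_op (subdifferential f))° !=set0 ->
    maximally_monotone Tf) /\
  (* xi *)
  (BC_function F /\ BC_function F_T) /\
  (* xii *)
  (conic_hull (minkowski_sub (snd @` efdom F_T) (snd @` efdom F)) = setT /\
   ((exists (v0 : X) (vs0 : dual X),
       (fs vs0 + fss (bidual_emb v0 - Astar vs0)%R < (vs0 v0)%:E)%E) ->
    ~ BC_function (inf_conv1 F_T F))) /\
  (* xiii *)
  (closed_subspace (minkowski_sub (@bidual_emb R X @^-1` range A)
                                  (conic_hull (efdom f))) ->
   efdom (fss \o Astar) !=set0 ->
   ~ (efdom (fss \o Astar) `<=` [set xs : dual X | e xs = 0]) ->
   ~ type_D Tf) /\
  (* xiv *)
  (efdom fss = setT -> maximally_monotone Tf /\ ~ type_D Tf).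
Proof.
move=> Astar P S T fs fss F F_T C Tf.
have /choice[B BA] : forall x, exists b, bidual_emb b = A x.
  by move=> x; have [b _ bx] := ranA _ (imageT A x); exists b.
have TA z x : T z x <-> e x = 0 /\ bidual_emb z = - A x.
  by split=> -[ex zx]; split=> //; move: zx;
    rewrite /S /= (skew_partE cA Ae) ex scale0r subr0.
have BE z x : bidual_emb z = - A x <-> z = - B x.
  split=> [|->]; last by rewrite linearN /= BA.
  by move=> zx; apply: emb_inj; rewrite zx linearN /= BA.
have TE : T = skew_rel e B.
  apply/funext => z; apply/seteqP; split=> x.
    by move=> /TA[ex /BE].
  by move=> [ex zx]; apply/TA; split=> //; exact/BE.
have CE : C = [set p : X * dual X | p.1 = - B p.2].
  by apply/seteqP; split=> p /BE.
have notD u : fss (Astar u) \is a fin_num -> e u != 0 -> ~ type_D Tf.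
  by rewrite /Tf TE; exact: sum_not_type_D.
split; first by apply/seteqP; split=> p /TA.
split.
  split; first exact: (quadratic_maximally_monotone Ae).
    exact: (quadratic_not_type_D eX Ae ranA).
  exact: (quadratic_not_unique eX Ae ranA).
split; first exact: (symmetric_partE cA Ae).
rewrite /F_T /Tf CE TE.
split.
  split; first exact: (skew_rel_maximal eX Ae BA).
  by split; [exact: skew_rel_linear|move=> x xs; exact: (skew_rel_skew Ae BA)].
split.
  rewrite (skew_rel_adjoint Ae BA); apply/seteqP.
  by split=> q [x [r ->]]; exists x, r; rewrite /S (skew_partE cA Ae).
split; first exact: (skew_rel_opp_not_maximal eX Ae BA).
split; first exact: (skew_rel_not_type_D eX Ae BA).
split; first exact: (skew_rel_fitzpatrick eX Ae BA).
split; first exact: (skew_rel_not_unique eX Ae BA).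
split; first exact: (skew_rel_not_type_BR eX Ae BA).
split; first exact: (sum_maximally_monotone_interior eX Ae BA).
split; first by split; [exact: separable_BC|exact: (fitzpatrick_BC eX Ae BA)].
split.
  split; first exact: (conic_hull_domains eX Ae BA).
  by move=> [v0 [y0 h]]; exact: (inf_conv_not_BC eX Ae BA f_proper f_lsc f_convex h).
split.
  move=> _ _ hsub; apply: contrapT => /contrapT D; apply: hsub => u fssu.
  apply: contrapT => /eqP eu; apply: (notD u) => //.
  by rewrite /Tf TE.
move=> fssT; split; first exact: (sum_maximally_monotone_finite eX Ae BA).
have [u eu] := bidual_outside_unit eX.
have := notD u; rewrite /Tf TE; apply; last by rewrite eu oner_eq0.
by have : efdom fss (Astar u) by rewrite fssT.
Qed.
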